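(* Let $a,b,c,d,u_0,\omega_0\in\mathbb{R}$ with $b\neq 0$, and let $f\in L^1(\mathbb{R})$. Put $$\gamma=\inf\left\{\left|\tfrac{u}{b}\right| : u\in\operatorname{supp}(\mathcal{O}^M f)\right\},\qquad R=\gamma^{-1}.$$ Then $\mathcal{O}^M f$ vanishes in a neighborhood of the origin if and only if $B^n f$ is well-defined and belongs to $L^1(\mathbb{R})$ for all $n\in\mathbb{Z}_+$ and $$\lim_{n\to\infty}\|B^n f\|_2^{1/n}=R<\infty .$$
   Context: For real parameters $M=\{a,b,c,d,u_0,\omega_0\}$ with $b\ne 0$, the offset linear canonical transform (OLCT) of $f\in L^1(\mathbb{R})$ is $$(\mathcal{O}^M f)(u)=\int_{\mathbb{R}}\mathcal{K}_M(u,x)f(x)\,dx,\qquad \mathcal{K}_M(u,x)=\sqrt{\tfrac{1}{2\pi i b}}\;e^{\frac{i}{2b}du_0^2}\,e^{\frac{i}{2b}\left(ax^2+2x(u_0-u)-2u(du_0-b\omega_0)+du^2\right)}$$ (principal square root). The operator $B$ is $$(Bf)(x)=e^{-\frac{i}{2b}(ax^2+2xu_0)}\int_x^{\infty}e^{\frac{i}{2b}(at^2+2tu_0)}f(t)\,dt ,$$ and $B^n$ is its $n$-fold iterate; $\mathbb{Z}_+$ denotes the positive integers and $\|\cdot\|_2$ the $L^2(\mathbb{R})$ norm. Conventions: $\inf\emptyset=\infty$, $\infty^{-1}=0$, $0^{-1}=\infty$. *)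

(* Defs.v *)
From HB Require Import structures.
From mathcomp Require Import all_boot all_order all_algebra.
From mathcomp Require Import all_classical all_reals all_analysis.
From mathcomp Require Import complex.

Set Implicit Arguments.
Unset Strict Implicit.
Unset Printing Implicit Defensive.

Import Order.TTheory GRing.Theory Num.Theory.
Import numFieldNormedType.Exports.

Local Open Scope classical_set_scope.
Local Open Scope ring_scope.
Local Open Scope complex_scope.

                        
Definition expi (R : realType) (t : R) : R[i] := cos t +i* sin t.

                                                                            
                                                                
Definition cintegrable (R : realType) (D : set R) (f : R -> R[i]) : Prop :=
  (@lebesgue_measure R).-integrable D (fun x => (complex.Re (f x))%:E) /\
  (@lebesgue_measure R).-integrable D (fun x => (complex.Im (f x))%:E).

Definition cintegral (R : realType) (D : set R) (f : R -> R[i]) : R[i] :=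
  (\int[@lebesgue_measure R]_(x in D) complex.Re (f x)) +i*
  (\int[@lebesgue_measure R]_(x in D) complex.Im (f x)).

Definition L2norm (R : realType) (f : R -> R[i]) : \bar R :=
  Lnorm (@lebesgue_measure R) 2%:E
    (fun x => (ComplexField.Normc.normc (f x))%:E).

Definition fsupp (R : realType) (g : R -> R[i]) : set R :=
  closure [set u | g u != 0].

                                                                       
                                                                   
                                                   
Definition olct_kernel (R : realType) (a b c d u0 w0 u x : R) : R[i] :=
  sqrtc (1 / ((2 * pi)%:C * 'i%C * b%:C)) *
  expi ((2 * b)^-1 * (d * u0 ^+ 2)) *
  expi ((2 * b)^-1 * (a * x ^+ 2 + 2 * x * (u0 - u)
                      - 2 * u * (d * u0 - b * w0) + d * u ^+ 2)).

Definition olct (R : realType) (a b c d u0 w0 : R) (f : R -> R[i]) (u : R)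
    : R[i] :=
  cintegral setT (fun x => olct_kernel a b c d u0 w0 u x * f x).

Definition chirp (R : realType) (a b u0 t : R) : R :=
  (2 * b)^-1 * (a * t ^+ 2 + 2 * t * u0).

Definition Bop (R : realType) (a b u0 : R) (f : R -> R[i]) : R -> R[i] :=
  fun x => expi (- chirp a b u0 x) *
    cintegral `[x, +oo[ (fun t => expi (chirp a b u0 t) * f t).

                                                                            
                         
Definition Bop_defined (R : realType) (a b u0 : R) (f : R -> R[i]) : Prop :=
  forall x : R,
    cintegrable `[x, +oo[ (fun t => expi (chirp a b u0 t) * f t).

Definition Bpow (R : realType) (a b u0 : R) (n : nat) (f : R -> R[i])
    : R -> R[i] :=
  iter n (Bop a b u0) f.

Definition Bpow_defined (R : realType) (a b u0 : R) (n : nat)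
    (f : R -> R[i]) : Prop :=
  forall k : nat, (k < n)%N -> Bop_defined a b u0 (Bpow a b u0 k f).

                                                     
Definition olct_gap (R : realType) (a b c d u0 w0 : R) (f : R -> R[i])
    : \bar R :=
  ereal_inf [set `|u / b|%:E | u in fsupp (olct a b c d u0 w0 f)].

                                                   
Definition olct_radius (R : realType) (a b c d u0 w0 : R) (f : R -> R[i])
    : \bar R :=
  ((olct_gap a b c d u0 w0 f)^-1)%E.

(* Main.v *)
Require Import Defs.
From HB Require Import structures.
From mathcomp Require Import all_boot all_order all_algebra.
From mathcomp Require Import all_classical all_reals all_analysis.
From mathcomp Require Import complex.
From mathcomp Require Import measurable_realfun ring lra.

(** Multiplying f by a chirp turns the OLCT at u into a unimodular multiple of
    the Fourier transform of a function p + i q at u / b, and turns B into the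
    operator J p (x) = int_x^oo p acting separately on p and q. So one has to
    show that, if |xi| < g is the largest symmetric interval on which the cosine
    and sine transforms of p vanish, then ||J^n p||_2^(1/n) -> 1 / g.

    J p is integrable: for a nonnegative mollifier phi (the square of a dilated
    Fejer kernel) whose Fourier transform lives in the gap, p * phi = 0, hence
    (int phi) (J p)(x) is the integral of p(t) phi(u - t) (1_{x <= t} - 1_{x <= u})
    over t and u, and phi has a finite first moment. Comparing J p with its
    translate by pi / xi shows that J divides the transform by - i xi.

    Both growth bounds come from testing h = J^n p against the Fejer kernel F:
    the integral of h(x) h(y) F(l (x - y)) is a weighted integral of the energy
    |h^|^2 over [0, l]. Schur's test bounds it above by a multiple of ||h||_2^2
    (lower bound), and l -> oo turns it into Plancherel's inequality (upper
    bound). *)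

Import Order.TTheory GRing.Theory Num.Theory.
Import numFieldNormedType.Exports.

Local Open Scope classical_set_scope.
Local Open Scope ring_scope.
Local Open Scope complex_scope.

Set Implicit Arguments.
Unset Strict Implicit.
Unset Printing Implicit Defensive.

(** * Absolutely integrable real functions: substitution, Fubini, dominated convergence *)

Section AbsolutelyIntegrable.
Context {R : realType}.
Notation mu := (@lebesgue_measure R).
Implicit Types (f g h k : R -> R) (a b c x y : R).

(* A record rather than a definition, so that unification never unfolds it. *)
Record L1 f : Prop := MkL1 { L1_integrable : mu.-integrable setT (EFin \o f) }.

Lemma L1_measurable f : L1 f -> measurable_fun setT f.
Proof. by move=> [/measurable_int /measurable_EFinP]. Qed.

Lemma L1_le f g : measurable_fun setT f -> L1 g ->
  (forall x, `|f x| <= g x) -> L1 f.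
Proof.
move=> mf [ig] fg; split; apply: (le_integrable measurableT _ _ ig).
  exact/measurable_EFinP.
by move=> x _; rewrite /= !lee_fin (le_trans (fg x))// ler_norm.
Qed.

Lemma L1_norm f : L1 f -> L1 (fun x => `|f x|).
Proof. by move=> [/integrable_norm]. Qed.

Lemma L1D f g : L1 f -> L1 g -> L1 (fun x => f x + g x).
Proof. by move=> [fi] [gi]; split; exact: (integrableD measurableT fi gi). Qed.

Lemma L1B f g : L1 f -> L1 g -> L1 (fun x => f x - g x).
Proof. by move=> [fi] [gi]; split; exact: (integrableB measurableT fi gi). Qed.

Lemma L1Zl c f : L1 f -> L1 (fun x => c * f x).
Proof. by move=> [/(integrableZl measurableT c)]. Qed.

Lemma L1Mr f k M : L1 f -> measurable_fun setT k ->
  (forall x, `|k x| <= M) -> L1 (fun x => f x * k x).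
Proof.
move=> fi mk kM; apply: (@L1_le _ (fun x => M * `|f x|)).
- by apply: measurable_funM => //; exact: L1_measurable.
- by apply: L1Zl; exact: L1_norm.
- by move=> x; rewrite normrM mulrC ler_wpM2r.
Qed.

Lemma Rintegral_EFin f : L1 f -> ((\int[mu]_x f x)%:E = \int[mu]_x (f x)%:E)%E.
Proof.
by move=> [fi]; rewrite /Rintegral fineK//; exact: integrable_fin_num.
Qed.

Lemma eq_RintegralT f g : (forall x, f x = g x) ->
  \int[mu]_x f x = \int[mu]_x g x.
Proof. by move=> fg; apply: eq_Rintegral => x _. Qed.

Lemma RintegralTZl c f : L1 f -> \int[mu]_x (c * f x) = c * \int[mu]_x f x.
Proof. by move=> [fi]; exact: RintegralZl. Qed.

Lemma RintegralTD f g : L1 f -> L1 g ->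
  \int[mu]_x (f x + g x) = \int[mu]_x f x + \int[mu]_x g x.
Proof. by move=> [fi] [gi]; exact: RintegralD. Qed.

Lemma RintegralTB f g : L1 f -> L1 g ->
  \int[mu]_x (f x - g x) = \int[mu]_x f x - \int[mu]_x g x.
Proof. by move=> [fi] [gi]; exact: RintegralB. Qed.

Lemma L1_ge0P f : measurable_fun setT f -> (forall x, 0 <= f x) ->
  L1 f <-> (\int[mu]_x (f x)%:E < +oo)%E.
Proof.
move=> mf f0; have E : (\int[mu]_x `|(f x)%:E| = \int[mu]_x (f x)%:E)%E.
  by apply: eq_integral => x _; rewrite gee0_abs// lee_fin.
split=> [[/integrableP[_]]|foo]; first by rewrite E.
by split; apply/integrableP; split; [exact/measurable_EFinP|rewrite E].
Qed.

Let affine_measurable a b : measurable_fun setT (fun x : R => a * x + b).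
Proof. by apply: measurable_funD => //; exact: measurable_funM. Qed.

(* Lebesgue measure scaled by |a| and pushed forward by x |-> a x + b is
   again Lebesgue measure, as one checks on half-open intervals. *)
Lemma ge0_integral_affine a b (f : R -> \bar R) : a != 0 ->
  measurable_fun setT f -> (forall x, 0 <= f x)%E ->
  (\int[mu]_x f x = `|a|%:E * \int[mu]_x f (a * x + b)%R)%E.
Proof.
move=> a0 mf f0.
pose T : measurableTypeR R -> measurableTypeR R := fun x : R => a * x + b.
have mT : measurable_fun setT T by exact: affine_measurable.
pose m := measure_function_pushforward__canonical__measure_function_Measure mu mT.
pose m' : {measure set (measurableTypeR R) -> \bar R} := mscale (NngNum (normr_ge0 a)) m.
have mE A : measurable A -> mu A = m' A.
  apply: lebesgue_measure_unique => _ [[c d] _ <-].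
  have -> : m' `]c, d]%classic = (`|a|%:E * mu (T @^-1` `]c, d]%classic))%E by [].
  have [a_gt0|a_lt0|/esym/eqP] := ltrgtP 0 a; last by rewrite (negPf a0).
  - have -> : T @^-1` `]c, d] = `](c - b) / a, (d - b) / a]%classic.
      apply/seteqP; split=> x /=; rewrite /T !in_itv/= ltr_pdivrMr// ler_pdivlMr//;
      by rewrite ltrBlDr lerBrDr (mulrC x).
    rewrite !lebesgue_measure_itv /= !lte_fin ltr_pM2r ?invr_gt0// ltrD2r.
    case: ifP => _; last by rewrite mule0.
    by rewrite -!EFinB -EFinM gtr0_norm//; congr EFin; field.
  - have -> : T @^-1` `]c, d] = `[(d - b) / a, (c - b) / a[%classic.
      apply/seteqP; split=> x /=; rewrite /T !in_itv/= ler_ndivrMr// ltr_ndivlMr//;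
      by rewrite ltrBlDr lerBrDr (mulrC x) andbC.
    rewrite !lebesgue_measure_itv /= !lte_fin ltr_nM2r ?invr_lt0// ltrD2r.
    case: ifP => _; last by rewrite mule0.
    by rewrite -!EFinB -EFinM ltr0_norm//; congr EFin; field.
transitivity (\int[m']_x f x)%E.
  by apply: eq_measure_integral => A mA _; exact: mE.
rewrite ge0_integral_mscale//; congr (_ * _)%E.
by rewrite ge0_integral_pushforward.
Qed.

Lemma measurable_affine a b f : measurable_fun setT f ->
  measurable_fun setT (fun x => f (a * x + b)).
Proof. by move=> mf; apply: measurableT_comp => //; exact: affine_measurable. Qed.

Lemma L1_affine a b f : a != 0 -> L1 f -> L1 (fun x => f (a * x + b)).
Proof.
move=> a0 fi; have mf := L1_measurable fi.
split; apply/integrableP; split.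
  by apply/measurable_EFinP; exact: measurable_affine.
have := L1_integrable fi => /integrableP[_].
rewrite (@ge0_integral_affine a b)//; last first.
  by apply/measurable_EFinP/measurableT_comp.
rewrite /=; case: (integral _ _ _) => [r _|//|//]; first by rewrite ltry.
by rewrite gt0_muley// lte_fin normr_gt0.
Qed.

Lemma Rintegral_affine a b f : a != 0 -> L1 f ->
  \int[mu]_x f x = `|a| * \int[mu]_x f (a * x + b).
Proof.
move=> a0 fi; have mf := L1_measurable fi.
have fi' := L1_affine b a0 fi.
apply: EFin_inj; rewrite EFinM !Rintegral_EFin//.
rewrite integralE [in RHS]integralE.
have mf' : measurable_fun setT (EFin \o f) by exact/measurable_EFinP.
rewrite (ge0_integral_affine b a0 (measurable_funepos mf'))//.
rewrite (ge0_integral_affine b a0 (measurable_funeneg mf'))//.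
rewrite [RHS]muleBr//; last first.
  exact/fin_num_adde_defr/(integrable_pos_fin_num measurableT (L1_integrable fi')).
by congr (_ * _ - _ * _)%E; apply: eq_integral => x _;
  rewrite ?funeposE ?funenegE.
Qed.

Lemma Tonelli (k : R -> R -> R) :
  measurable_fun setT (fun z : R * R => k z.1 z.2) ->
  (forall x y, 0 <= k x y) ->
  (\int[mu]_x \int[mu]_y (k x y)%:E = \int[mu]_y \int[mu]_x (k x y)%:E)%E.
Proof.
move=> mk k0; pose K := fun z : R * R => (k z.1 z.2)%:E.
have mK : measurable_fun setT K by exact/measurable_EFinP.
have K0 z : (0 <= K z)%E by rewrite lee_fin.
exact: (@fubini_tonelli _ _ _ _ _ mu mu K mK K0).
Qed.

Lemma measurable_sectionl (k : R -> R -> R) x :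
  measurable_fun setT (fun z : R * R => k z.1 z.2) -> measurable_fun setT (k x).
Proof.
move=> mk; rewrite [k x](_ : _ = (fun z : R * R => k z.1 z.2) \o pair x)//.
exact: measurableT_comp.
Qed.

Lemma measurable_swap2 (k : R -> R -> R) :
  measurable_fun setT (fun z : R * R => k z.1 z.2) ->
  measurable_fun setT (fun z : R * R => k z.2 z.1).
Proof.
move=> mk.
rewrite [X in measurable_fun _ X](_ : _ =
  (fun z : R * R => k z.1 z.2) \o (fun z => (z.2, z.1)))//.
apply: measurableT_comp => //.
by apply/measurable_fun_pairP; split => /=; [exact: measurable_snd|exact: measurable_fst].
Qed.

Lemma measurable_sectionr (k : R -> R -> R) y :
  measurable_fun setT (fun z : R * R => k z.1 z.2) -> measurable_fun setT (k ^~ y).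
Proof.
by move=> /measurable_swap2 mk; exact: (@measurable_sectionl (fun y x => k x y)).
Qed.

Lemma L1_integral_fst (k : R -> R -> R) :
  measurable_fun setT (fun z : R * R => k z.1 z.2) ->
  (\int[mu]_x \int[mu]_y `|k x y|%:E < +oo)%E -> (forall x, L1 (k x)) ->
  L1 (fun x => \int[mu]_y k x y).
Proof.
move=> mk koo kx; pose K := fun z : R * R => (k z.1 z.2)%:E.
have mK : measurable_fun setT K by exact/measurable_EFinP.
have iK : (mu \x mu)%E.-integrable setT K.
  by apply: (integrable12ltyP mu mu mK).2.
split; have := integrable_fubini_F iK; apply: eq_integrable => // x _ /=.
by rewrite Rintegral_EFin.
Qed.

Lemma L1_integral_snd (k : R -> R -> R) :
  measurable_fun setT (fun z : R * R => k z.1 z.2) ->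
  (\int[mu]_x \int[mu]_y `|k x y|%:E < +oo)%E -> (forall y, L1 (k ^~ y)) ->
  L1 (fun y => \int[mu]_x k x y).
Proof.
move=> mk koo ky.
apply: (@L1_integral_fst (fun y x => k x y) (measurable_swap2 mk) _ ky).
by rewrite -(@Tonelli (fun x y => `|k x y|))//; exact: measurableT_comp.
Qed.

Lemma L1_Fubini (k : R -> R -> R) :
  measurable_fun setT (fun z : R * R => k z.1 z.2) ->
  (\int[mu]_x \int[mu]_y `|k x y|%:E < +oo)%E ->
  (forall x, L1 (k x)) -> (forall y, L1 (k ^~ y)) ->
  \int[mu]_x \int[mu]_y k x y = \int[mu]_y \int[mu]_x k x y.
Proof.
move=> mk koo kx ky.
pose K := fun z : R * R => (k z.1 z.2)%:E.
have mK : measurable_fun setT K by exact/measurable_EFinP.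
have iK : (mu \x mu)%E.-integrable setT K.
  by apply: (integrable12ltyP mu mu mK).2.
apply: EFin_inj; rewrite (Rintegral_EFin (L1_integral_fst mk koo kx)).
rewrite (Rintegral_EFin (L1_integral_snd mk koo ky)).
transitivity (\int[mu]_x \int[mu]_y K (x, y))%E.
  by apply: eq_integral => x _; rewrite Rintegral_EFin.
rewrite Fubini//.
by apply: eq_integral => y _; rewrite (Rintegral_EFin (ky y)).
Qed.

(** Supplies the finiteness hypothesis of Fubini from a single real estimate: the inner integrals of
    [|k|] are dominated by an integrable function of the outer variable. *)
Lemma iterated_integral_lty (k : R -> R -> R) (B : R -> R) :
  measurable_fun setT (fun z : R * R => k z.1 z.2) -> L1 B ->
  (forall x, L1 (k x)) -> (forall x, \int[mu]_y `|k x y| <= B x) ->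
  (\int[mu]_x \int[mu]_y `|k x y|%:E < +oo)%E.
Proof.
move=> mk Bi ki kB'.
have kB x : (\int[mu]_y `|k x y|%:E <= (B x)%:E)%E.
  by rewrite -(Rintegral_EFin (L1_norm (ki x))) lee_fin.
pose K := fun z : R * R => `|k z.1 z.2|%:E.
have mK : measurable_fun setT K.
  by apply/measurable_EFinP; exact: measurableT_comp mk.
have K0 z : (0 <= K z)%E by rewrite lee_fin.
have B0 x : (0 <= (B x)%:E)%E.
  by apply: le_trans (kB x); apply: integral_ge0 => y _; rewrite lee_fin.
apply: (@le_lt_trans _ _ (\int[mu]_x (B x)%:E)%E).
  apply: ge0_le_integral => //.
  + by move=> x _; apply: integral_ge0 => y _; rewrite lee_fin.
  + exact: (@measurable_fun_fubini_tonelli_F _ _ _ _ _ mu K mK K0).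
  + by apply/measurable_EFinP; exact: L1_measurable.
by rewrite -(Rintegral_EFin Bi) ltry.
Qed.

Lemma ler_normr_Rintegral f : L1 f -> `|\int[mu]_x f x| <= \int[mu]_x `|f x|.
Proof. by move=> [fi]; exact: le_normr_Rintegral. Qed.

Lemma ler_Rintegral f g : L1 f -> L1 g -> (forall x, f x <= g x) ->
  \int[mu]_x f x <= \int[mu]_x g x.
Proof. by move=> [fi] [gi] fg; apply: le_Rintegral. Qed.

Section BoundedKernel.
Context (f g : R -> R) (k : R -> R -> R) (M : R).
Context (fi : L1 f) (gi : L1 g)
  (mk : measurable_fun setT (fun z : R * R => k z.1 z.2))
  (kM : forall x y, `|k x y| <= M).

Let kxi x : L1 (fun y => g y * k x y).
Proof. exact: (L1Mr gi (measurable_sectionl x mk) (kM x)). Qed.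

Let kyi y : L1 (fun x => f x * k x y).
Proof. exact: (L1Mr fi (measurable_sectionr y mk) (kM ^~ y)). Qed.

Let fgki x : L1 (fun y => f x * (g y * k x y)).
Proof. exact: L1Zl. Qed.

Let measurable_fgk :
  measurable_fun setT (fun z : R * R => f z.1 * (g z.2 * k z.1 z.2)).
Proof.
apply: measurable_funM.
  exact: (measurableT_comp (L1_measurable fi) measurable_fst).
by apply: measurable_funM => //;
  exact: (measurableT_comp (L1_measurable gi) measurable_snd).
Qed.

(** As [|k| <= M], the inner integral is at most M ||g||_1 |f x|, which is integrable in x. *)
Let fgk_lty :
  (\int[mu]_x \int[mu]_y `|f x * (g y * k x y)|%:E < +oo)%E.
Proof.
apply: (@iterated_integral_lty (fun x y => f x * (g y * k x y))
  (fun x => (M * \int[mu]_y `|g y|) * `|f x|) measurable_fgk) => [||x].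
- exact/L1Zl/L1_norm.
- exact: fgki.
rewrite mulrC.
rewrite -(RintegralTZl _ (L1_norm gi)) -RintegralTZl; last exact/L1Zl/L1_norm.
apply: ler_Rintegral; [exact: L1_norm|exact/L1Zl/L1Zl/L1_norm|] => y.
by rewrite !normrM ler_wpM2l// mulrC ler_wpM2r.
Qed.

Lemma L1_bounded_kernel : L1 (fun x => f x * \int[mu]_y (g y * k x y)).
Proof.
have := L1_integral_fst measurable_fgk fgk_lty fgki.
by under eq_fun do rewrite RintegralTZl//.
Qed.

Lemma Fubini_bounded :
  \int[mu]_x (f x * \int[mu]_y (g y * k x y)) =
  \int[mu]_y (g y * \int[mu]_x (f x * k x y)).
Proof.
transitivity (\int[mu]_x \int[mu]_y (f x * (g y * k x y))).
  by apply: eq_RintegralT => x; rewrite RintegralTZl.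
rewrite (L1_Fubini measurable_fgk fgk_lty fgki).
  apply: eq_RintegralT => y; rewrite -(RintegralTZl _ (kyi y)).
  by apply: eq_RintegralT => x; rewrite mulrCA.
by move=> y; under eq_fun do rewrite mulrCA; exact: L1Zl.
Qed.

End BoundedKernel.

Lemma ae_neq x : {ae mu, forall y, y != x}.
Proof.
exists [set x]; split=> //; first exact: lebesgue_measure_set1.
by move=> y /= /negP; rewrite negbK => /eqP.
Qed.

Lemma Rintegral_dominated (u : nat -> R -> R) f g : L1 g ->
  (forall n, measurable_fun setT (u n)) -> measurable_fun setT f ->
  (forall n x, `|u n x| <= g x) ->
  {ae mu, forall x, u n x @[n --> \oo] --> f x} ->
  \int[mu]_x u n x @[n --> \oo] --> \int[mu]_x f x.
Proof.
move=> gi mu_ mf ug uf.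
have ui n : L1 (u n) := L1_le (mu_ n) gi (ug n).
have [] := @dominated_convergence _ _ R mu setT measurableT
  (fun n x => (u n x)%:E) (EFin \o f) (EFin \o g) _ _ _ (L1_integrable gi).
- by move=> n; apply/measurable_EFinP; exact: mu_.
- exact/measurable_EFinP.
- case: uf => N [mN N0 subN]; exists N; split=> // x nx.
  by apply: subN => ux; apply: nx => _; apply: cvg_EFin => //; exact: nearW.
- by apply: aeW => x n _; rewrite lee_fin.
move=> /MkL1 fi _ ufE.
have {}ufE : ((\int[mu]_x u n x)%:E @[n --> \oo] --> (\int[mu]_x f x)%:E)%E.
  rewrite (Rintegral_EFin fi).
  by under eq_fun do rewrite (Rintegral_EFin (ui _)).
by move/fine_cvgP : ufE => [].
Qed.

End AbsolutelyIntegrable.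

(** * Cosine and sine transforms *)

Section Trigonometric.
Context {R : realType}.
Notation mu := (@lebesgue_measure R).
Implicit Types (f g h : R -> R) (a b x y s xi th : R).

Lemma Rintegral_indic f (A : set R) :
  \int[mu]_x (f x * \1_A x) = \int[mu]_(x in A) f x.
Proof.
rewrite [RHS]Rintegral_mkcond; apply: eq_RintegralT => x.
by rewrite patch_indic.
Qed.

Lemma Rintegral_FTC (F f : R -> R) a b : a < b ->
  (forall x, is_derive x 1 F (f x)) -> continuous f ->
  \int[mu]_(x in `[a, b]) f x = F b - F a.
Proof.
move=> ab dF cf; have cF x : {for x, continuous F}.
  by apply/differentiable_continuous/derivable1_diffP; have [] := dF x.
apply: EFin_inj; rewrite EFinB -(@continuous_FTC2 _ f F)//.
- rewrite /Rintegral fineK//; apply: integrable_fin_num => //.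
  apply: continuous_compact_integrable; first exact: segment_compact.
  exact: continuous_subspaceT.
- exact: continuous_subspaceT.
- split; first by move=> x _; have [] := dF x.
  + exact/cvg_at_right_filter/cF.
  + exact/cvg_at_left_filter/cF.
- by move=> x _; rewrite derive1E; have [_ ->] := dF x.
Qed.

(** By continuity f stays above [f x / 2] on an interval around x, so f dominates a positive
    multiple of the indicator of that interval. *)
Lemma Rintegral_gt0 f x : L1 f -> (forall y, 0 <= f y) ->
  {for x, continuous f} -> 0 < f x -> 0 < \int[mu]_y f y.
Proof.
move=> fi f0 cf fx.
have : \forall y \near x, f x / 2 < f y.
  by apply: (@cvgr_gt R R (nbhs x) _ f (f x) cf (f x / 2)); lra.
move=> [e /= e0 He].
apply: (@lt_le_trans _ _ (\int[mu]_y
  (f x / 2 * \1_(`[x - e / 2, x + e / 2]%classic : set R) y))).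
  have E : lebesgue_measure (`[x - e / 2, x + e / 2]%classic : set R) = e%:E.
    rewrite lebesgue_measure_itv /= lte_fin.
    have -> : x - e / 2 < x + e / 2 by lra.
    by rewrite -EFinB; congr EFin; field.
  rewrite Rintegral_indic Rintegral_cst//.
  by rewrite [X in fine X]E /= mulr_gt0// divr_gt0.
apply: ler_Rintegral => // [|y].
  by apply: L1Zl; split; exact: integrable_indic_itv.
rewrite indicE; case: (boolP (y \in _)) => [|_]; last by rewrite mulr0.
rewrite inE /= in_itv/= mulr1 => /andP[y1 y2]; apply/ltW/He.
by rewrite /ball_/= ltr_distlC; apply/andP; split; lra.
Qed.

Lemma L1_oneDsqrV : L1 (fun y : R => (1 + y ^+ 2)^-1).
Proof.
have c0 : continuous (fun y : R => (1 + y ^+ 2)^-1).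
  exact: (@continuous_oneDsqrV R).
apply/L1_ge0P => [|x|].
- exact: continuous_measurable_fun.
- by rewrite invr_ge0 addr_ge0// sqr_ge0.
- rewrite ge0_symfun_integralT//.
  + rewrite [X in (_ * X)%E](_ : _ = (pi / 2)%:E) -?EFinM ?ltry//.
    rewrite -integral0y_oneDsqr; congr integral.
    by apply/seteqP; split=> x; rewrite /= in_itv/= andbT.
  + by move=> x; rewrite invr_ge0 addr_ge0// sqr_ge0.
  + by move=> x /=; rewrite sqrrN.
Qed.

(** The phase packs both real transforms into one: th = 0 gives the cosine transform, th = pi / 2
    the sine transform, and by [trigE] these two determine all the others. *)
Definition trig f xi th : R := \int[mu]_x (f x * cos (xi * x - th)).

Lemma continuous_cos_affine a b : continuous (fun x : R => cos (a * x - b)).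
Proof.
move=> x; apply: continuous_comp; last exact: continuous_cos.
by apply: cvgB; [apply: cvgM; [exact: cvg_cst|exact: cvg_id]|exact: cvg_cst].
Qed.

Lemma measurable_cos_affine a b : measurable_fun setT (fun x : R => cos (a * x - b)).
Proof. by apply: continuous_measurable_fun; exact: continuous_cos_affine. Qed.

Lemma normr_cos_le1 x : `|cos x| <= 1.
Proof. by rewrite ler_norml cos_geN1 cos_le1. Qed.

Lemma L1_cos f a b : L1 f -> L1 (fun x => f x * cos (a * x - b)).
Proof.
move=> fi; apply: (L1Mr fi (measurable_cos_affine _ _)) => x.
exact: normr_cos_le1.
Qed.

Lemma trigE f xi th : L1 f ->
  trig f xi th = cos th * trig f xi 0 + sin th * trig f xi (pi / 2).
Proof.
move=> fi; rewrite /trig -!RintegralTZl; try exact: L1_cos.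
rewrite -RintegralTD; try by apply: L1Zl; exact: L1_cos.
apply: eq_RintegralT => x.
by rewrite subr0 cosB (cosB _ (pi / 2)) cos_pihalf sin_pihalf; ring.
Qed.

Lemma trig_le f xi th : L1 f -> `|trig f xi th| <= \int[mu]_x `|f x|.
Proof.
move=> fi; apply: (le_trans (ler_normr_Rintegral _)); first exact: L1_cos.
apply: ler_Rintegral; [exact/L1_norm/L1_cos|exact: L1_norm|] => x.
by rewrite normrM ler_piMr// normr_cos_le1.
Qed.

Lemma trigN f xi th : trig f (- xi) th = trig f xi (- th).
Proof.
by apply: eq_RintegralT => x; rewrite -cosN; congr (_ * cos _); ring.
Qed.

Lemma continuous_trig f th : L1 f -> continuous (trig f ^~ th).
Proof.
move=> fi xi.
have := @continuity_under_integral R _ _ mu (fun xi x => f x * cos (xi * x - th))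
  setT measurableT (xi - 1) (xi + 1) _ _ (fun x => `|f x|) (L1_integrable (L1_norm fi)) _.
apply => //.
- by move=> a _; apply: L1_integrable; exact: L1_cos.
- apply: aeW => x _ a _; apply: cvgM; first exact: cvg_cst.
  rewrite (mulrC a); under eq_fun do rewrite mulrC.
  exact: continuous_cos_affine.
- move=> a _; apply: aeW => x _.
  by rewrite normrM ler_piMr// normr_cos_le1.
- by rewrite inE/= in_itv/=; lra.
Qed.

End Trigonometric.

(** * The Fejer kernel and its triangular weight *)

Section Fejer.
Context {R : realType}.
Notation mu := (@lebesgue_measure R).
Implicit Types (f g h : R -> R) (a b x y s xi th l : R).

(** The factor 2 makes up for keeping only half of the triangle 1 - |s| on [-1, 1]; the cosine
    transform [fejer] is then (sin (y / 2) / (y / 2))^2. *)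
Definition fejer_weight s : R := 2 * (1 - s) * \1_(`[0, 1]%classic : set R) s.

Definition fejer y : R := trig fejer_weight y 0.

Lemma indic01E s : \1_(`[0, 1]%classic : set R) s = (0 <= s <= 1)%R%:R :> R.
Proof.
rewrite indicE; congr (nat_of_bool _)%:R; apply/idP/idP.
  by rewrite inE /= in_itv.
by rewrite inE /= in_itv.
Qed.

Lemma fejer_weight_ge0 s : 0 <= fejer_weight s.
Proof.
rewrite /fejer_weight indic01E; case: (boolP (0 <= s <= 1)) => [/andP[s0 s1]|_].
  by rewrite mulr1 mulr_ge0// subr_ge0.
by rewrite mulr0.
Qed.

Lemma fejer_weight_le s : fejer_weight s <= 2 * \1_(`[0, 1]%classic : set R) s.
Proof.
rewrite /fejer_weight indic01E; case: (boolP (0 <= s <= 1)) => [/andP[s0 s1]|_] /=.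
  by lra.
by rewrite !mulr0.
Qed.

Lemma fejer_weight_out s : ~~ (0 <= s <= 1) -> fejer_weight s = 0.
Proof. by rewrite /fejer_weight indic01E => /negPf ->; rewrite mulr0. Qed.

Let L1_indic01 : L1 (\1_(`[0, 1]%classic : set R) : R -> R).
Proof. by split; exact: integrable_indic_itv. Qed.

Lemma L1_fejer_weight : L1 fejer_weight.
Proof.
apply: (@L1_le _ _ (fun s => 2 * \1_(`[0, 1]%classic : set R) s)).
- apply: measurable_funM; last exact: (L1_measurable L1_indic01).
  by apply: measurable_funM => //; apply: measurable_funB.
- exact: L1Zl.
- by move=> x; rewrite ger0_norm ?fejer_weight_ge0// fejer_weight_le.
Qed.

Lemma fejer_weight_continuous s : 0 < s -> s < 1 ->
  {for s, continuous fejer_weight}.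
Proof.
move=> s0 s1.
have E : \forall x \near s, 2 * (1 - x) = fejer_weight x.
  near=> x; rewrite /fejer_weight indic01E.
  suff -> : 0 <= x <= 1 by rewrite mulr1.
  by apply/andP; split; apply: ltW; near: x; [exact: lt_nbhsr|exact: lt_nbhsl].
have Es := nbhs_singleton E; rewrite /= in Es.
rewrite /prop_for /continuous_at -Es.
apply: cvg_trans; first exact: (near_eq_cvg E).
apply: cvgM; first exact: cvg_cst.
by apply: cvgB; [exact: cvg_cst|exact: cvg_id].
Unshelve. all: by end_near. Qed.

Lemma fejerE y : y != 0 -> fejer y = 2 * (1 - cos y) / y ^+ 2.
Proof.
move=> y0.
transitivity (\int[mu]_(s in `[0, 1]) (2 * (1 - s) * cos (y * s))).
  rewrite -Rintegral_indic; apply: eq_RintegralT => s.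
  by rewrite /fejer_weight subr0 mulrAC.
(* The antiderivative comes from one integration by parts. *)
pose F s := 2 * ((1 - s) * sin (y * s) / y - cos (y * s) / y ^+ 2).
have dF s : is_derive s 1 F (2 * (1 - s) * cos (y * s)).
  by apply: is_derive_eq; rewrite /GRing.scale/=; field.
rewrite (@Rintegral_FTC _ F)//.
  by rewrite /F mulr0 mulr1 subrr sin0 cos0; field.
move=> s; apply: cvgM.
  by apply: cvgM; [exact: cvg_cst|apply: cvgB; [exact: cvg_cst|exact: cvg_id]].
apply: (@continuous_comp _ _ _ ( *%R y) cos); last exact: continuous_cos.
exact: mulrl_continuous.
Qed.

Lemma fejer_ge0 y : 0 <= fejer y.
Proof.
have [->|y0] := eqVneq y 0.
  apply: Rintegral_ge0 => x _.
  by rewrite mul0r subr0 cos0 mulr1 fejer_weight_ge0.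
by rewrite fejerE// divr_ge0// ?sqr_ge0// mulr_ge0// subr_ge0 cos_le1.
Qed.

(** The constant is 2 + 4: the kernel is at most 2, the integral of a bound on its weight, and its
    product with y^2 is 2 (1 - cos y) <= 4. *)
Lemma fejer_bound y : fejer y <= 6 * (1 + y ^+ 2)^-1.
Proof.
have W : fejer y <= 2.
  apply: (le_trans (ler_norm _)); apply: (le_trans (trig_le _ _ L1_fejer_weight)).
  apply: (@le_trans _ _ (\int[mu]_x (2 * \1_(`[0, 1]%classic : set R) x))).
    apply: ler_Rintegral => [||x]; [exact/L1_norm/L1_fejer_weight|exact: L1Zl|].
    by rewrite ger0_norm ?fejer_weight_ge0// fejer_weight_le.
  rewrite Rintegral_indic Rintegral_cst//.
  have E : lebesgue_measure (`[0, 1]%classic : set R) = 1%:E.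
    by rewrite lebesgue_measure_itv /= lte_fin ltr01 sube0.
  by rewrite [X in fine X]E /= mulr1.
have p : 0 < 1 + y ^+ 2 by rewrite ltr_pwDl// sqr_ge0.
rewrite ler_pdivlMr// mulrDr mulr1.
have [y0|y0] := eqVneq y 0; first by rewrite [in y ^+ 2]y0 expr0n /= mulr0 addr0; lra.
have : fejer y * y ^+ 2 <= 4.
  by rewrite fejerE// divfK ?sqrf_eq0//; have := cos_geN1 y; lra.
by lra.
Qed.

Lemma fejerN y : fejer (- y) = fejer y.
Proof. by rewrite /fejer trigN oppr0. Qed.

Lemma continuous_fejer : continuous fejer.
Proof. by move=> y; exact: (@continuous_trig _ _ 0 L1_fejer_weight y). Qed.

Lemma measurable_fejer : measurable_fun setT fejer.
Proof. by apply: continuous_measurable_fun; exact: continuous_fejer. Qed.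

Lemma L1_fejer : L1 fejer.
Proof.
apply: (L1_le measurable_fejer (L1Zl 6 L1_oneDsqrV)) => y.
by rewrite ger0_norm ?fejer_ge0 ?fejer_bound.
Qed.

Lemma fejer_pi_gt0 : 0 < fejer pi.
Proof.
rewrite fejerE ?gt_eqF ?pi_gt0// cospi divr_gt0// ?exprn_gt0 ?pi_gt0//; lra.
Qed.

Lemma Rintegral_fejer_gt0 : 0 < \int[mu]_y fejer y.
Proof.
exact: (Rintegral_gt0 L1_fejer fejer_ge0 (@continuous_fejer _) fejer_pi_gt0).
Qed.

Lemma fejer_le2 y : `|fejer y| <= 6.
Proof.
rewrite ger0_norm ?fejer_ge0// (le_trans (fejer_bound y))// ler_piMr// invf_le1.
  by rewrite lerDl sqr_ge0.
by rewrite ltr_pwDl// sqr_ge0.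
Qed.

(** Writing the kernel as an average of cosines and exchanging the integrals shows that convolution
    with it only sees the frequencies of h in [0, l]. *)
Lemma Rintegral_fejerM h l x : L1 h ->
  \int[mu]_y (h y * fejer (l * (x - y))) =
  \int[mu]_s (fejer_weight s * trig h (l * s) (l * s * x)).
Proof.
move=> hi.
transitivity (\int[mu]_y (h y * \int[mu]_s (fejer_weight s * cos (l * (x - y) * s)))).
  apply: eq_RintegralT => y; congr (_ * _); apply: eq_RintegralT => s.
  by rewrite subr0.
have mk : measurable_fun setT (fun z : R * R => cos (l * (x - z.1) * z.2)).
  apply: measurableT_comp.
    by apply: continuous_measurable_fun; exact: continuous_cos.
  apply: measurable_funM => //; apply: measurable_funM => //.
  exact: measurable_funB.
rewrite (Fubini_bounded (k := fun y s => cos (l * (x - y) * s)) hi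
  L1_fejer_weight mk (fun _ _ => normr_cos_le1 _)).
apply: eq_RintegralT => s; congr (_ * _); apply: eq_RintegralT => y.
by congr (_ * _); rewrite -cosN; congr cos; ring.
Qed.

End Fejer.

(** * Spectral energy and its comparison with the L2 norm *)

Section Energy.
Context {R : realType}.
Notation mu := (@lebesgue_measure R).
Implicit Types (f g h : R -> R) (a b x y s xi th l : R).

(** For real f this is the squared modulus of the Fourier transform at xi. *)
Definition energy f xi : R := trig f xi 0 ^+ 2 + trig f xi (pi / 2) ^+ 2.

Lemma energy_ge0 f xi : 0 <= energy f xi.
Proof. by rewrite addr_ge0// sqr_ge0. Qed.

Lemma continuous_energy f : L1 f -> continuous (energy f).
Proof.
move=> fi xi; have c th := @continuous_trig _ _ th fi xi.
by apply: cvgD; apply: cvgM; exact: c.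
Qed.

Lemma energy_le f xi : L1 f -> energy f xi <= 2 * (\int[mu]_x `|f x|) ^+ 2.
Proof.
move=> fi.
have sq th : trig f xi th ^+ 2 <= (\int[mu]_x `|f x|) ^+ 2.
  rewrite -[leLHS]real_normK ?num_real// ler_sqr ?nnegrE//.
    exact: trig_le.
  exact: Rintegral_ge0.
by rewrite /energy mulr_natl mulr2n lerD.
Qed.

(** By [trigE], the function [trig f xi (xi * x)] is C cos (xi x) + S sin (xi x), with C and S the
    two transforms of f at xi; integrating it against f gives C^2 + S^2. *)
Lemma trig_phase f xi th : L1 f ->
  \int[mu]_x (f x * trig f xi (xi * x)) = energy f xi.
Proof.
move=> fi.
transitivity (\int[mu]_x (trig f xi 0 * (f x * cos (xi * x - 0)) +
    trig f xi (pi / 2) * (f x * cos (xi * x - pi / 2)))).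
  apply: eq_RintegralT => x.
  rewrite (trigE _ (xi * x) fi) subr0 (cosB _ (pi / 2)) cos_pihalf sin_pihalf; ring.
rewrite RintegralTD ?RintegralTZl//; try by do ?apply: L1Zl; exact: L1_cos.
Qed.

Lemma measurable_trig_phase f l : L1 f ->
  measurable_fun setT (fun z : R * R => trig f (l * z.2) (l * z.2 * z.1)).
Proof.
move=> fi.
have mt th : measurable_fun setT (fun z : R * R => trig f (l * z.2) th).
  apply: (@measurableT_comp _ _ _ _ _ _ (fun s => trig f (l * s) th) _ snd) => //.
  apply: (@measurableT_comp _ _ _ _ _ _ (trig f ^~ th)).
    by apply: continuous_measurable_fun; exact: continuous_trig.
  exact: measurable_funM.
have mp : measurable_fun setT (fun z : R * R => l * z.2 * z.1).
  by do 2 apply: measurable_funM => //.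
(* This takes the phase out of [trig]: each factor is now a continuous function of one measurable
   expression. *)
under eq_fun do rewrite (trigE _ _ fi).
apply: measurable_funD; apply: measurable_funM => //.
  apply: measurableT_comp mp.
  by apply: continuous_measurable_fun; exact: continuous_cos.
apply: measurableT_comp mp.
by apply: continuous_measurable_fun; exact: continuous_sin.
Qed.

Lemma Rintegral_fejer_energy h l : L1 h ->
  \int[mu]_x (h x * \int[mu]_y (h y * fejer (l * (x - y)))) =
  \int[mu]_s (fejer_weight s * energy h (l * s)).
Proof.
move=> hi.
transitivity (\int[mu]_x
  (h x * \int[mu]_s (fejer_weight s * trig h (l * s) (l * s * x)))).
  by apply: eq_RintegralT => x; rewrite Rintegral_fejerM.
rewrite (Fubini_bounded (k := fun x s => trig h (l * s) (l * s * x)) hi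
  (@L1_fejer_weight _) (measurable_trig_phase l hi) (fun _ _ => trig_le _ _ hi)).
by apply: eq_RintegralT => s; rewrite trig_phase.
Qed.

Lemma L1_fejer_weight_energy h l : L1 h ->
  L1 (fun s => fejer_weight s * energy h (l * s)).
Proof.
move=> hi; apply: (L1Mr (@L1_fejer_weight _) _ (M := 2 * (\int[mu]_x `|h x|) ^+ 2)).
- apply: (@measurableT_comp _ _ _ _ _ _ (energy h)); last exact: measurable_funM.
  by apply: continuous_measurable_fun; exact: continuous_energy.
- by move=> x; rewrite ger0_norm ?energy_ge0// energy_le.
Qed.

Lemma fejer_dilation l x : l != 0 ->
  \int[mu]_y fejer (l * (x - y)) = `|l|^-1 * \int[mu]_y (@fejer R y).
Proof.
move=> l0; have nl0 : - l != 0 by rewrite oppr_eq0.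
rewrite (Rintegral_affine (l * x) nl0 (@L1_fejer R)).
rewrite normrN mulKf; last by rewrite normr_eq0.
apply: eq_RintegralT => y.
by congr fejer; ring.
Qed.

Lemma measurable_fejerB l :
  measurable_fun setT (fun z : R * R => fejer (l * (z.1 - z.2))).
Proof.
apply: measurableT_comp; first exact: measurable_fejer.
by apply: measurable_funM => //; exact: measurable_funB.
Qed.

Lemma L1_fejerB l x : l != 0 -> L1 (fun y => fejer (l * (x - y))).
Proof.
move=> l0; have := @L1_affine _ (- l) (l * x) _ _ (@L1_fejer R).
rewrite oppr_eq0 => /(_ l0); congr L1; apply/funext => y; congr fejer; ring.
Qed.

Lemma ler_mul_half_sqr x y a : 0 <= a ->
  x * (y * a) <= 2^-1 * (x ^+ 2 * a + y ^+ 2 * a).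
Proof.
move=> a0; rewrite -subr_ge0.
have -> : 2^-1 * (x ^+ 2 * a + y ^+ 2 * a) - x * (y * a) =
    2^-1 * a * (x - y) ^+ 2 by field.
by rewrite mulr_ge0 ?sqr_ge0// mulr_ge0.
Qed.

(* Schur's test: h x * h y is at most the half-sum of their squares. *)
Lemma fejer_weight_energy_le h l : 0 < l -> L1 h -> L1 (fun x => h x ^+ 2) ->
  \int[mu]_s (fejer_weight s * energy h (l * s)) <=
  (\int[mu]_y (@fejer R y)) / l * \int[mu]_x h x ^+ 2.
Proof.
move=> l0 hi h2i; rewrite -Rintegral_fejer_energy//.
have l0' : l != 0 by rewrite gt_eqF.
set kap := \int[mu]_y (@fejer R y).
(* [k1 x y] and [k1 y x] are the two halves of the majorant; by Fubini both have total integral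
   [kap / l] times that of h^2. *)
pose k1 x y := h x ^+ 2 * fejer (l * (x - y)).
have mk1 : measurable_fun setT (fun z : R * R => k1 z.1 z.2).
  apply: measurable_funM; last exact: measurable_fejerB.
  exact: (measurableT_comp (L1_measurable h2i) measurable_fst).
have k1E x : \int[mu]_y k1 x y = kap / l * h x ^+ 2.
  rewrite RintegralTZl; last exact: L1_fejerB.
  by rewrite fejer_dilation// gtr0_norm// -/kap; ring.
have k1i x : L1 (k1 x) by apply: L1Zl; exact: L1_fejerB.
have k1i' y : L1 (k1 ^~ y).
  apply: (L1Mr h2i) => [|x]; last exact: fejer_le2.
  exact: (measurable_sectionr (k := fun x y => fejer (l * (x - y))) y
    (measurable_fejerB l)).
have k1oo : (\int[mu]_x \int[mu]_y `|k1 x y|%:E < +oo)%E.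
  apply: (@iterated_integral_lty _ k1 (fun x => kap / l * h x ^+ 2));
    [exact: mk1|exact: L1Zl|exact: k1i|move=> x].
  rewrite -k1E le_eqVlt; apply/orP; left; apply/eqP/eq_RintegralT => y.
  by rewrite ger0_norm// mulr_ge0 ?sqr_ge0 ?fejer_ge0.
have G1 := L1_integral_fst (k := k1) mk1 k1oo k1i.
have G2 := L1_integral_snd (k := k1) mk1 k1oo k1i'.
have FE := L1_Fubini (k := k1) mk1 k1oo k1i k1i'.
have hk := L1_bounded_kernel (k := fun x y => fejer (l * (x - y))) hi hi
  (measurable_fejerB l) (fun _ _ => fejer_le2 _).
have -> : kap / l * \int[mu]_x h x ^+ 2 =
    \int[mu]_x (2^-1 * (\int[mu]_y k1 x y + \int[mu]_y k1 y x)).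
  rewrite [RHS](RintegralTZl _ (L1D G1 G2)).
  rewrite [in RHS](RintegralTD G1 G2).
  have A : \int[mu]_x \int[mu]_y k1 x y = kap / l * \int[mu]_x h x ^+ 2.
    by rewrite (eq_RintegralT k1E) (RintegralTZl _ h2i).
  rewrite [X in _ * (X + _)]A [X in _ * (_ + X)](etrans (esym FE) A).
  by move: (Rintegral _ _ _) => H; field.
have hki x : L1 (fun y => h y * fejer (l * (x - y))).
  apply: (L1Mr hi) => [|y]; last exact: fejer_le2.
  exact: (measurable_sectionl (k := fun x y => fejer (l * (x - y))) x
    (measurable_fejerB l)).
apply: (ler_Rintegral hk (L1Zl 2^-1 (L1D G1 G2))) => x.
rewrite -(RintegralTD (k1i x) (k1i' x)) -(RintegralTZl _ (L1D (k1i x) (k1i' x))).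
rewrite -(RintegralTZl _ (hki x)).
apply: (ler_Rintegral (L1Zl (h x) (hki x)) (L1Zl 2^-1 (L1D (k1i x) (k1i' x)))) => y.
(* The kernel is even, so both halves carry the same factor [fejer (l * (x - y))]. *)
rewrite /k1 -(fejerN (l * (y - x))).
have -> : - (l * (y - x)) = l * (x - y) by ring.
exact/ler_mul_half_sqr/fejer_ge0.
Qed.

End Energy.

(** * Plancherel's inequality through an approximate identity *)

Section Plancherel.
Context {R : realType}.
Notation mu := (@lebesgue_measure R).
Implicit Types (f g h : R -> R) (a b x y s xi th l : R).

(** The weight is at most 2, and the substitution y = l s absorbs the factor l, which makes the
    bound uniform in l. *)
Lemma fejer_weight_energy_le_decay h l (M : R) : 0 < l -> L1 h ->
  (forall xi, energy h xi <= M * (1 + xi ^+ 2)^-1) ->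
  l * \int[mu]_s (fejer_weight s * energy h (l * s)) <=
  2 * M * \int[mu]_y (1 + y ^+ 2)^-1.
Proof.
move=> l0 hi hM; have l0' : l != 0 by rewrite gt_eqF.
have pos y : 0 <= (1 + y ^+ 2)^-1 :> R by rewrite invr_ge0 addr_ge0// sqr_ge0.
have M0 : 0 <= M.
  have := le_trans (energy_ge0 h 0) (hM 0).
  by rewrite expr0n addr0 invr1 mulr1.
rewrite (Rintegral_affine 0 l0' L1_oneDsqrV) gtr0_norm// mulrCA.
apply: ler_wpM2l; first exact: ltW.
have ai := L1_affine 0 l0' (@L1_oneDsqrV R).
rewrite -(RintegralTZl _ ai).
apply: (ler_Rintegral (L1_fejer_weight_energy l hi) (L1Zl _ ai)) => s.
rewrite addr0 -mulrA; apply: ler_pM.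
- exact: fejer_weight_ge0.
- exact: energy_ge0.
- apply: (le_trans (fejer_weight_le s)); rewrite indicE.
  by case: (_ \in _); rewrite ?mulr1 ?mulr0.
- exact: hM.
Qed.

(** Substituting y = x - v / (n + 1) moves the dilation into h; the integrands are dominated by B
    times the kernel and converge pointwise by continuity of h. *)
Lemma fejer_approx_identity h (B : R) x : continuous h -> (forall x, `|h x| <= B) ->
  (n.+1%:R * \int[mu]_y (h y * fejer (n.+1%:R * (x - y)))) @[n --> \oo] -->
  h x * \int[mu]_y (@fejer R y).
Proof.
move=> ch hB.
have hFi l z : l != 0 -> L1 (fun y => h y * fejer (l * (z - y))).
  move=> l0; under eq_fun do rewrite mulrC.
  apply: (L1Mr (L1_fejerB z l0)) => //.
  exact: continuous_measurable_fun.
have E n : n.+1%:R * \int[mu]_y (h y * fejer (n.+1%:R * (x - y))) =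
    \int[mu]_v (fejer v * h (x - n.+1%:R^-1 * v)).
  have n0 : n.+1%:R != 0 :> R by rewrite pnatr_eq0.
  have nV : - n.+1%:R^-1 != 0 :> R by rewrite oppr_eq0 invr_eq0.
  rewrite (Rintegral_affine x nV (hFi _ x n0)) normrN gtr0_norm ?invr_gt0//.
  rewrite mulrA divff// mul1r; apply: eq_RintegralT => v.
  rewrite mulrC; congr (fejer _ * h _); last by ring.
  by field.
have -> : h x * \int[mu]_y (@fejer R y) = \int[mu]_v (fejer v * h x).
  rewrite -(RintegralTZl _ (@L1_fejer R)).
  by apply: eq_RintegralT => v; rewrite mulrC.
under eq_fun do rewrite E.
apply: (@Rintegral_dominated _ (fun n v => fejer v * h (x - n.+1%:R^-1 * v))
  _ (fun v => B * fejer v)).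
- exact/L1Zl/L1_fejer.
- move=> n; apply: measurable_funM; first exact: measurable_fejer.
  apply: (@measurableT_comp _ _ _ _ _ _ h); first exact: continuous_measurable_fun.
  by apply: measurable_funB => //; exact: measurable_funM.
- by apply: measurable_funM => //; exact: measurable_fejer.
- by move=> n v; rewrite normrM mulrC (ger0_norm (fejer_ge0 v)) ler_wpM2r ?fejer_ge0.
- apply: aeW => v; apply: cvgM; first exact: cvg_cst.
  apply: (@cvg_comp _ _ _ (fun n => x - n.+1%:R^-1 * v) h _ (nbhs x)); last exact: ch.
  suff : x - n.+1%:R^-1 * v @[n --> \oo] --> x - 0 * v by rewrite mul0r subr0.
  apply: cvgB; first exact: cvg_cst.
  by apply: cvgM; [exact: cvg_harmonic|exact: cvg_cst].
Qed.

(** The Fejer quadratic form at l = n + 1, multiplied by l, is bounded uniformly in n by the decay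
    of the energy. Its integrands are dominated by [(B * kap) * |h x|], and by the approximate
    identity the form tends to the left-hand side. *)
Lemma plancherel_le h (M B : R) : L1 h -> continuous h ->
  (forall x, `|h x| <= B) ->
  (forall xi, energy h xi <= M * (1 + xi ^+ 2)^-1) ->
  (\int[mu]_y (@fejer R y)) * \int[mu]_x h x ^+ 2 <=
  2 * M * \int[mu]_y (1 + y ^+ 2)^-1.
Proof.
move=> hi ch hB hM; set kap := \int[mu]_y (@fejer R y).
have mh : measurable_fun setT h := L1_measurable hi.
have h2i : L1 (fun x => h x ^+ 2) by apply: (L1Mr hi mh hB).
pose u n x := h x * (n.+1%:R * \int[mu]_y (h y * fejer (n.+1%:R * (x - y)))).
have uE n x : u n x =
    n.+1%:R * (h x * \int[mu]_y (h y * fejer (n.+1%:R * (x - y)))).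
  by rewrite /u mulrCA.
have ki n := L1_bounded_kernel (k := fun x y => fejer (n.+1%:R * (x - y)))
  hi hi (measurable_fejerB n.+1%:R) (fun _ _ => fejer_le2 _).
have mu_ n : measurable_fun setT (u n).
  rewrite (funext (uE n)); apply: measurable_funM => //.
  exact: (L1_measurable (ki n)).
have u_le n : \int[mu]_x u n x <= 2 * M * \int[mu]_y (1 + y ^+ 2)^-1.
  rewrite (eq_RintegralT (uE n)) (RintegralTZl _ (ki n)).
  rewrite (Rintegral_fejer_energy _ hi).
  exact: fejer_weight_energy_le_decay.
have ub n x : `|u n x| <= (B * kap) * `|h x|.
  rewrite /u normrM mulrC ler_wpM2r//.
  have n0 : 0 < n.+1%:R :> R by [].
  have n0' : n.+1%:R != 0 :> R by rewrite gt_eqF.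
  have fi := L1_fejerB x n0'.
  have hfi : L1 (fun y => h y * fejer (n.+1%:R * (x - y))).
    apply: (L1Mr hi) => [|y]; last exact: fejer_le2.
    exact: L1_measurable.
  rewrite normrM gtr0_norm//.
  apply: (@le_trans _ _ (n.+1%:R * \int[mu]_y (B * fejer (n.+1%:R * (x - y))))).
    apply: ler_wpM2l; first exact: ltW.
    apply: (le_trans (ler_normr_Rintegral hfi)).
    apply: (ler_Rintegral (L1_norm hfi) (L1Zl _ fi)) => y.
    by rewrite normrM (ger0_norm (fejer_ge0 _)) ler_wpM2r ?fejer_ge0.
  rewrite (RintegralTZl _ fi) fejer_dilation// gtr0_norm// mulrCA mulVKf//.
have ulim : \int[mu]_x u n x @[n --> \oo] --> \int[mu]_x (kap * h x ^+ 2).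
  apply: (Rintegral_dominated (L1Zl (B * kap) (L1_norm hi)) mu_ _ ub).
    exact: (L1_measurable (L1Zl _ h2i)).
  apply: aeW => x; rewrite expr2 mulrCA; apply: cvgM; first exact: cvg_cst.
  by rewrite (mulrC kap); exact: (fejer_approx_identity ch hB).
rewrite -(RintegralTZl _ h2i).
apply: (@ler_cvg_to _ _ _ _ _ (cst (2 * M * \int[mu]_y (1 + y ^+ 2)^-1)) _ _ ulim).
  exact: cvg_cst.
exact: nearW.
Qed.

End Plancherel.

(** * The tail operator, spectral gaps and mollifiers *)

Section Tail.
Context {R : realType}.
Notation mu := (@lebesgue_measure R).
Implicit Types (f g h p : R -> R) (a b x y t u s xi th l eta : R).

(** This is the operator J; [BpowE] relates its iterates to those of B. *)
Definition tail p x : R := \int[mu]_(t in `[x, +oo[) p t.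

Lemma tailE p x : tail p x = \int[mu]_t (p t * (x <= t)%R%:R).
Proof.
rewrite /tail -Rintegral_indic; apply: eq_RintegralT => t.
rewrite indicE; congr (_ * (nat_of_bool _)%:R); apply/idP/idP.
  by rewrite inE /= in_itv /= andbT.
by rewrite inE /= in_itv /= andbT.
Qed.

Lemma measurable_natb d (T : measurableType d) (b : T -> bool) :
  measurable_fun setT b -> measurable_fun setT (fun z => (b z)%:R : R).
Proof.
move=> mb; rewrite [X in measurable_fun _ X](_ : _ = (fun z => if b z then 1 else 0)).
  exact: measurable_fun_ifT.
by apply/funext => z; case: (b z).
Qed.

Lemma normr_natb_le1 (b : bool) : `|b%:R : R| <= 1.
Proof. by case: b; rewrite ?normr1 ?normr0. Qed.

Lemma measurable_le_natb d (T : measurableType d) (f g : T -> R) :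
  measurable_fun setT f -> measurable_fun setT g ->
  measurable_fun setT (fun z => (f z <= g z)%R%:R : R).
Proof. by move=> mf mg; apply: measurable_natb; exact: measurable_fun_ler. Qed.

Lemma L1_tail_integrand p x : L1 p -> L1 (fun t => p t * (x <= t)%R%:R).
Proof.
move=> ip; apply: (L1Mr ip _ (M := 1)) => [|t]; last exact: normr_natb_le1.
exact: measurable_le_natb.
Qed.

Lemma tail_bound p x : L1 p -> `|tail p x| <= \int[mu]_t `|p t|.
Proof.
move=> ip; have pxi := L1_tail_integrand x ip.
rewrite tailE (le_trans (ler_normr_Rintegral pxi))//.
apply: (ler_Rintegral (L1_norm pxi) (L1_norm ip)) => t.
by rewrite normrM ler_piMr// normr_natb_le1.
Qed.

Lemma continuous_tail p : L1 p -> continuous (tail p).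
Proof.
move=> ip x; apply/(@cvg_nbhsP R R^o) => u ux.
rewrite tailE (_ : (fun n => _) = fun n => \int[mu]_t (p t * (u n <= t)%R%:R)).
2: by apply/funext => n; exact: tailE.
apply: (@Rintegral_dominated _ (fun n t => p t * (u n <= t)%R%:R) _ (fun t => `|p t|)).
- exact: L1_norm.
- by move=> n; exact: L1_measurable (L1_tail_integrand _ ip).
- exact: L1_measurable (L1_tail_integrand _ ip).
- by move=> n t; rewrite normrM ler_piMr// normr_natb_le1.
(* For t distinct from x the indicator of [u n <= t] is eventually constant; the exceptional point t
   = x is a null set. *)
- case: (ae_neq x) => N [mN N0 subN]; exists N; split=> // t nt.
  apply: subN => tx; apply: nt; apply: cvgM; first exact: cvg_cst.
  apply: cvg_near_cst.
  have /orP[xt|tx'] : (x < t) || (t < x) by rewrite -neq_lt eq_sym.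
  + rewrite (ltW xt); near=> n; suff -> : u n <= t by [].
    by apply/ltW; near: n; exact: (cvgr_lt x).
  + rewrite leNgt tx' /=; near=> n; suff /negbTE -> : ~~ (u n <= t) by [].
    by rewrite -ltNge; near: n; exact: (cvgr_gt x).
Unshelve. all: by end_near. Qed.

Definition spectral_gap a p := forall xi th, `|xi| < a -> trig p xi th = 0.

Lemma trigM_cos p s th xi th' : L1 p ->
  trig (fun y => p y * cos (s * y - th)) xi th' =
  2^-1 * (trig p (s + xi) (th + th') + trig p (s - xi) (th - th')).
Proof.
move=> ip; rewrite -RintegralTD; try exact: L1_cos.
rewrite -RintegralTZl; last by apply: L1D; exact: L1_cos.
apply: eq_RintegralT => y.
rewrite (_ : (s + xi) * y - (th + th') = (s * y - th) + (xi * y - th')); last by ring.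
rewrite (_ : (s - xi) * y - (th - th') = (s * y - th) - (xi * y - th')); last by ring.
by rewrite (cosD (s * y - th)) (cosB (s * y - th)); field.
Qed.

(** The transform of the product at xi is an average of transforms of p at xi + eta s and xi - eta s
    with s in [0, 1], hence only eta of the gap is lost. *)
Lemma spectral_gap_fejerM a p eta u : L1 p -> 0 <= eta -> spectral_gap a p ->
  spectral_gap (a - eta) (fun t => p t * fejer (eta * (u - t))).
Proof.
move=> ip eta0 gp xi th xia.
transitivity (\int[mu]_t (p t * cos (xi * t - th) * fejer (eta * (u - t)))).
  by apply: eq_RintegralT => t; rewrite mulrAC.
rewrite Rintegral_fejerM; last exact: L1_cos.
rewrite (@eq_RintegralT _ _ (fun=> 0)); first by rewrite /Rintegral integral0.
move=> s; have [/andP[s0 s1]|s01] := boolP (0 <= s <= 1); last first.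
  by rewrite (fejer_weight_out s01) mul0r.
have es : `|eta * s| <= eta by rewrite ger0_norm ?mulr_ge0// ler_piMr.
rewrite trigM_cos// !gp ?addr0 ?mulr0//.
- by have := ler_normB xi (eta * s); lra.
- by have := ler_normD xi (eta * s); lra.
Qed.

Section Mollifier.
Context (eta : R).
Context (eta0 : 0 < eta).

(** The square is there for the first moment: the kernel itself decays only like y^-2, its square
    like y^-4. *)
Definition mollifier y : R := fejer (eta * y) ^+ 2.

Lemma mollifier_ge0 y : 0 <= mollifier y.
Proof. exact: sqr_ge0. Qed.

(** Each of the two Fejer factors costs eta of the gap; what remains still contains the frequency 0,
    where the transform with phase 0 is the plain integral. *)
Lemma spectral_gap_mollifier a p u : L1 p -> 2 * eta < a -> spectral_gap a p ->
  \int[mu]_t (p t * mollifier (u - t)) = 0.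
Proof.
move=> ip ea gp; pose q t := p t * fejer (eta * (u - t)).
have qi : L1 q.
  apply: (L1Mr ip) => [|t]; last exact: fejer_le2.
  exact: (measurable_sectionl (k := fun x y => fejer (eta * (x - y))) u
    (measurable_fejerB eta)).
have gq : spectral_gap (a - eta) q by apply: spectral_gap_fejerM => //; exact: ltW.
transitivity (trig (fun t => q t * fejer (eta * (u - t))) 0 0).
  by apply: eq_RintegralT => t; rewrite mul0r subr0 cos0 mulr1 /mollifier expr2 mulrA.
apply: (@spectral_gap_fejerM (a - eta)) => //; first exact: ltW.
by rewrite normr0; lra.
Qed.

Lemma mollifier_le y : mollifier y <= 36 * (1 + (eta * y) ^+ 2)^-1 ^+ 2.
Proof.
rewrite /mollifier (_ : 36 = 6 ^+ 2); last by ring.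
rewrite -exprMn ler_sqr ?nnegrE ?fejer_ge0 ?fejer_bound//.
by rewrite mulr_ge0// invr_ge0 addr_ge0// sqr_ge0.
Qed.

Lemma measurable_mollifier : measurable_fun setT mollifier.
Proof.
apply: measurable_funX; apply: (@measurableT_comp _ _ _ _ _ _ fejer).
  exact: measurable_fejer.
exact: measurable_funM.
Qed.

Lemma L1_mollifier_moment : L1 (fun y => mollifier y * `|y|).
Proof.
have eta0' : eta != 0 by rewrite gt_eqF.
have := L1Zl (36 / eta) (L1_affine 0 eta0' (@L1_oneDsqrV R)).
move=> G; apply: (L1_le _ G) => [|y].
  apply: measurable_funM; first exact: measurable_mollifier.
  by apply: continuous_measurable_fun; exact: norm_continuous.
rewrite addr0 normrM normr_id ger0_norm ?mollifier_ge0//.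
apply: (le_trans (ler_wpM2r _ (mollifier_le y))) => //.
set z := eta * y; have -> : `|y| = `|z| / eta.
  by rewrite /z normrM gtr0_norm// mulrC mulKf.
have p : 0 < 1 + z ^+ 2 by rewrite ltr_pwDl// sqr_ge0.
(* One factor of the squared bound absorbs |z|, the other one remains integrable. *)
have : `|z| * (1 + z ^+ 2)^-1 <= 1.
  rewrite ler_pdivrMr// mul1r -[z ^+ 2]real_normK ?num_real//.
  by have := sqr_ge0 (`|z| - 1); have := normr_ge0 z; nra.
move=> H; have e0 : 0 <= 36 / eta * (1 + z ^+ 2)^-1.
  by rewrite mulr_ge0 ?divr_ge0 ?invr_ge0// ltW.
rewrite (_ : 36 * _ ^+ 2 * _ = (36 / eta * (1 + z ^+ 2)^-1) * (`|z| * (1 + z ^+ 2)^-1)).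
  by rewrite -[leRHS]mulr1 ler_wpM2l.
by rewrite expr2; field; rewrite eta0' gt_eqF.
Qed.

Lemma L1_mollifier : L1 mollifier.
Proof.
have eta0' : eta != 0 by rewrite gt_eqF.
have := L1Zl 36 (L1_affine 0 eta0' (@L1_oneDsqrV R)).
move=> G; apply: (L1_le _ G) => [|y]; first exact: measurable_mollifier.
rewrite addr0 ger0_norm ?mollifier_ge0// (le_trans (mollifier_le y))//.
rewrite ler_wpM2l// expr2 ler_piMr//.
  by rewrite invr_ge0 addr_ge0// sqr_ge0.
by rewrite invf_le1 ?lerDl ?sqr_ge0// ltr_pwDl// sqr_ge0.
Qed.

Lemma Rintegral_mollifier_gt0 : 0 < \int[mu]_y mollifier y.
Proof.
apply: (@Rintegral_gt0 _ _ (pi / eta) L1_mollifier mollifier_ge0).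
  have c : {for pi / eta, continuous (fun y => fejer (eta * y))}.
    apply: (@continuous_comp _ _ _ ( *%R eta) fejer); first exact: mulrl_continuous.
    exact: continuous_fejer.
  exact: cvgM.
by rewrite /mollifier mulrC divfK ?gt_eqF// exprn_gt0// fejer_pi_gt0.
Qed.

End Mollifier.

End Tail.

(** * Integrability of the tail and its transform *)

Section TailIntegrable.
Context {R : realType}.
Notation mu := (@lebesgue_measure R).
Implicit Types (f g h p : R -> R) (a b x y t u v s xi th l : R).

Lemma L1_ball_natb (r : R) : L1 (fun y : R => (`|y| <= r)%R%:R : R).
Proof.
have -> : (fun y : R => (`|y| <= r)%R%:R : R) = \1_(`[- r, r]%classic : set R).
  apply/funext => y; rewrite indicE ler_norml; congr (nat_of_bool _)%:R.
  by apply/idP/idP; rewrite inE /= in_itv.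
by split; exact: integrable_indic_itv.
Qed.

Lemma Rintegral_ball_natb (r : R) : 0 <= r ->
  \int[mu]_(y in setT) ((`|y| <= r)%R%:R : R) = 2 * r.
Proof.
move=> r0.
transitivity (\int[mu]_y (1 * \1_(`[- r, r]%classic : set R) y)).
  apply: eq_RintegralT => y; rewrite mul1r indicE ler_norml; congr (nat_of_bool _)%:R.
  by apply/idP/idP; rewrite inE /= in_itv.
have E : lebesgue_measure (`[- r, r]%classic : set R) = (2 * r)%:E.
  rewrite lebesgue_measure_itv /= lte_fin; case: ifPn => [_|].
    by rewrite -EFinB; congr EFin; ring.
  by rewrite -leNgt => rr; congr EFin; lra.
by rewrite Rintegral_indic Rintegral_cst// [X in fine X]E /= mul1r.
Qed.

Lemma L1_shift f t : L1 f -> L1 (fun x => f (x - t)).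
Proof.
move=> fi; have := L1_affine (- t) (oner_neq0 R) fi.
by under eq_fun do rewrite mul1r.
Qed.

Lemma Rintegral_shift f t : L1 f -> \int[mu]_x f (x - t) = \int[mu]_x f x.
Proof.
move=> fi; rewrite [RHS](Rintegral_affine (- t) (oner_neq0 R) fi) normr1 mul1r.
by apply: eq_RintegralT => x; rewrite mul1r.
Qed.

(** The two indicators differ only if x separates t from u, and then x is no farther from t than u
    is. *)
Lemma normr_le_natb_sub x t u :
  `|(x <= t)%R%:R - (x <= u)%R%:R| <= (`|x - t| <= `|u - t|)%R%:R :> R.
Proof.
case: (leP x t) => xt; case: (leP x u) => xu /=; rewrite ?subrr ?normr0 ?ler0n//.
- suff -> : `|x - t| <= `|u - t| by rewrite subr0 normr1.
  by rewrite !ler0_norm; lra.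
- suff -> : `|x - t| <= `|u - t| by rewrite sub0r normrN normr1.
  by rewrite !ger0_norm; lra.
Qed.

Section L1Tail.
Context (p phi : R -> R).
Context (ip : L1 p) (phi_i : L1 phi) (phi_moment : L1 (fun y => phi y * `|y|)).
Context (phi_ge0 : forall y, 0 <= phi y).
Context (phi_p : forall u, \int[mu]_t (p t * phi (u - t)) = 0).
Context (M : R) (phi_le : forall y, phi y <= M).

Let kap : R := \int[mu]_y phi y.

(** The mass of phi at distance at least |y| from the origin. *)
Let radial y : R := \int[mu]_v (phi v * (`|y| <= `|v|)%R%:R).

Let mphi : measurable_fun setT phi := L1_measurable phi_i.
Let mnorm : measurable_fun setT (fun y : R => `|y|).
Proof. by apply: continuous_measurable_fun; exact: norm_continuous. Qed.

Let L1_radial_integrand y : L1 (fun v => phi v * (`|y| <= `|v|)%R%:R).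
Proof.
apply: (L1Mr phi_i _ (M := 1)) => [|v]; last exact: normr_natb_le1.
exact: measurable_le_natb.
Qed.

Let radial_ge0 y : 0 <= radial y.
Proof. by apply: Rintegral_ge0 => v _; rewrite mulr_ge0. Qed.

Let radial_le y : radial y <= kap.
Proof.
apply: (ler_Rintegral (L1_radial_integrand y) phi_i) => v.
by case: (`|y| <= `|v|); rewrite /= ?mulr1 ?mulr0.
Qed.

(** Integrating over y first turns the indicator into 2 |v|, so the integral is controlled by the
    first moment of phi. *)
Let L1_radial : L1 radial.
Proof.
have mk : measurable_fun setT (fun z : R * R => phi z.1 * (`|z.2| <= `|z.1|)%R%:R).
  apply: measurable_funM; first exact: measurableT_comp mphi _.
  by apply: measurable_le_natb; exact: measurableT_comp mnorm _.
apply: (L1_integral_snd (k := fun v y => phi v * (`|y| <= `|v|)%R%:R) mk).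
  apply: (@iterated_integral_lty _ (fun v y => phi v * (`|y| <= `|v|)%R%:R)
    (fun v => 2 * (phi v * `|v|)) mk) => [||v].
  - exact: L1Zl.
  - by move=> v; apply: L1Zl; exact: L1_ball_natb.
  rewrite (@eq_RintegralT _ _ (fun y => phi v * (`|y| <= `|v|)%R%:R)); last first.
    by move=> y; rewrite ger0_norm// mulr_ge0.
  by rewrite (RintegralTZl _ (L1_ball_natb _)) Rintegral_ball_natb// mulrCA.
exact: L1_radial_integrand.
Qed.

(** The convolution of |p| with [radial], an integrable majorant for [kap] times |tail p|. *)
Let conv_norm x : R := \int[mu]_t (`|p t| * radial (x - t)).

Let mradial : measurable_fun setT radial := L1_measurable L1_radial.

Let L1_conv_section x : L1 (fun t => `|p t| * radial (x - t)).
Proof.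
apply: (L1Mr (L1_norm ip) _ (M := kap)) => [|t].
  by apply: (@measurableT_comp _ _ _ _ _ _ radial) => //; exact: measurable_funB.
by rewrite ger0_norm.
Qed.

Let L1_conv_norm : L1 conv_norm.
Proof.
have mk : measurable_fun setT (fun z : R * R => `|p z.1| * radial (z.2 - z.1)).
  apply: measurable_funM.
    exact: (measurableT_comp (L1_measurable (L1_norm ip)) measurable_fst).
  by apply: (@measurableT_comp _ _ _ _ _ _ radial) => //; exact: measurable_funB.
have si t : L1 (fun x => `|p t| * radial (x - t)) by apply: L1Zl; exact: L1_shift.
apply: (L1_integral_snd (k := fun t x => `|p t| * radial (x - t)) mk).
  apply: (@iterated_integral_lty _ (fun t x => `|p t| * radial (x - t))
    (fun t => (\int[mu]_y radial y) * `|p t|) mk _ si) => [|t].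
    exact/L1Zl/L1_norm.
  rewrite (@eq_RintegralT _ _ (fun x => `|p t| * radial (x - t))); last first.
    by move=> x; rewrite ger0_norm// mulr_ge0.
  by rewrite (RintegralTZl _ (L1_shift t L1_radial)) Rintegral_shift// mulrC.
exact: L1_conv_section.
Qed.

(** A smoothed form of [kap] times the indicator of x <= t. *)
Let cut x t : R := \int[mu]_u (phi (u - t) * (x <= u)%R%:R).

Let L1_cut x t : L1 (fun u => phi (u - t) * (x <= u)%R%:R).
Proof.
apply: (L1Mr (L1_shift t phi_i) _ (M := 1)) => [|u]; last exact: normr_natb_le1.
exact: measurable_le_natb.
Qed.

Let mcut x : measurable_fun setT
  (fun z : R * R => p z.1 * (phi (z.2 - z.1) * (x <= z.2)%R%:R)).
Proof.
apply: measurable_funM.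
  exact: (measurableT_comp (L1_measurable ip) measurable_fst).
apply: measurable_funM; last exact: measurable_le_natb.
by apply: (@measurableT_comp _ _ _ _ _ _ phi) => //; exact: measurable_funB.
Qed.

Let cut_lty x :
  (\int[mu]_t \int[mu]_u `|p t * (phi (u - t) * (x <= u)%R%:R)|%:E < +oo)%E.
Proof.
apply: (@iterated_integral_lty _ (fun t u => p t * (phi (u - t) * (x <= u)%R%:R))
  (fun t => kap * `|p t|) (mcut x)) => [|t|t].
- exact/L1Zl/L1_norm.
- exact/L1Zl/L1_cut.
rewrite mulrC /kap -(Rintegral_shift t phi_i).
rewrite -(RintegralTZl _ (L1_shift t phi_i)).
apply: (ler_Rintegral (L1_norm (L1Zl _ (L1_cut x t))) (L1Zl _ (L1_shift t phi_i))) => u.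
rewrite !normrM (ger0_norm (phi_ge0 _)) ler_wpM2l// ler_piMr//.
exact: normr_natb_le1.
Qed.

Let L1_p_cut x : L1 (fun t => p t * cut x t).
Proof.
have := L1_integral_fst (mcut x) (cut_lty x) (fun t => L1Zl (p t) (L1_cut x t)).
by under eq_fun do rewrite (RintegralTZl _ (L1_cut _ _)).
Qed.

(** Exchanging the integrals leaves the convolution of p and phi, which is zero, integrated over u
    >= x. *)
Let p_cut_eq0 x : \int[mu]_t (p t * cut x t) = 0.
Proof.
transitivity (\int[mu]_t \int[mu]_u (p t * (phi (u - t) * (x <= u)%R%:R))).
  by apply: eq_RintegralT => t; rewrite (RintegralTZl _ (L1_cut _ _)).
have si u : L1 (fun t => p t * (phi (u - t) * (x <= u)%R%:R)).
  apply: (L1Mr ip _ (M := M)) => [|t].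
    apply: measurable_funM => //.
    by apply: (@measurableT_comp _ _ _ _ _ _ phi) => //; exact: measurable_funB.
  rewrite ger0_norm ?mulr_ge0//; apply: le_trans (phi_le (u - t)).
  by case: (x <= u); rewrite /= ?mulr1 ?mulr0.
rewrite (L1_Fubini (mcut x) (cut_lty x) (fun t => L1Zl (p t) (L1_cut x t)) si).
rewrite (@eq_RintegralT _ _ (fun=> 0)); first by rewrite /Rintegral integral0.
move=> u; case: (x <= u) => /=.
  by under eq_RintegralT do rewrite mulr1; exact: phi_p.
rewrite (@eq_RintegralT _ _ (fun=> 0)); first by rewrite /Rintegral integral0.
by move=> t; rewrite !mulr0.
Qed.

(** By [p_cut_eq0], [cut] may be subtracted from [kap] times the indicator. The difference is the
    integral of phi (u - t) against a difference of two indicators, which [normr_le_natb_sub] bounds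
    by [radial (x - t)]. *)
Let tail_le x : kap * `|tail p x| <= conv_norm x.
Proof.
have kap0 : 0 <= kap by exact: Rintegral_ge0.
have pxi := L1_tail_integrand x ip.
have E : kap * tail p x = \int[mu]_t (p t * ((x <= t)%R%:R * kap - cut x t)).
  transitivity (\int[mu]_t (kap * (p t * (x <= t)%R%:R) - p t * cut x t)).
    by rewrite (RintegralTB (L1Zl _ pxi) (L1_p_cut x)) p_cut_eq0 subr0
      (RintegralTZl _ pxi) tailE.
  by apply: eq_RintegralT => t; ring.
have Ei : L1 (fun t => p t * ((x <= t)%R%:R * kap - cut x t)).
  have := L1B (L1Zl kap pxi) (L1_p_cut x).
  by congr L1; apply/funext => t; ring.
rewrite -[kap in leLHS]ger0_norm// -normrM E (le_trans (ler_normr_Rintegral Ei))//.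
apply: (ler_Rintegral (L1_norm Ei) (L1_conv_section x)) => t.
rewrite normrM ler_wpM2l//.
rewrite /kap -(Rintegral_shift t phi_i) -(RintegralTZl _ (L1_shift t phi_i)).
have Bi := L1B (L1Zl (x <= t)%R%:R (L1_shift t phi_i)) (L1_cut x t).
rewrite /cut -(RintegralTB (L1Zl (x <= t)%R%:R (L1_shift t phi_i)) (L1_cut x t)).
rewrite (le_trans (ler_normr_Rintegral Bi))//.
rewrite /radial -(Rintegral_shift t (L1_radial_integrand (x - t))).
apply: (ler_Rintegral (L1_norm Bi) (L1_shift t (L1_radial_integrand (x - t)))) => u.
rewrite mulrC -mulrBr normrM (ger0_norm (phi_ge0 _)) ler_wpM2l//.
exact: normr_le_natb_sub.
Qed.

Lemma L1_tail_mollified : 0 < kap -> L1 (tail p).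
Proof.
move=> kap0; apply: (L1_le _ (L1Zl kap^-1 L1_conv_norm)) => [|x].
  by apply: continuous_measurable_fun; exact: continuous_tail.
by rewrite mulrC ler_pdivlMr// mulrC tail_le.
Qed.

End L1Tail.

Lemma L1_tail p a : L1 p -> 0 < a -> spectral_gap a p -> L1 (tail p).
Proof.
(* The choice eta = a / 3 meets the requirement 2 eta < a. *)
move=> ip a0 gp; have e0 : 0 < a / 3 by rewrite divr_gt0.
have e2 : 2 * (a / 3) < a by lra.
apply: (@L1_tail_mollified p (mollifier (a / 3)) ip (L1_mollifier e0)
  (L1_mollifier_moment e0) (mollifier_ge0 (a / 3)) _ (6 ^+ 2)).
- by move=> u; exact: (spectral_gap_mollifier e0 u ip e2 gp).
- move=> y; rewrite /mollifier ler_sqr ?nnegrE ?fejer_ge0//.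
  by rewrite -[leLHS]ger0_norm ?fejer_ge0 ?fejer_le2.
- exact: Rintegral_mollifier_gt0.
Qed.

(* With a = pi / xi, translating by a changes the sign of cos (xi x - th),
   while tail p x - tail p (x + a) is the integral of p over [x, x + a[. *)
Lemma trig_tail_pos p xi th : L1 p -> L1 (tail p) -> 0 < xi ->
  trig (tail p) xi th = xi^-1 * trig p xi (th + pi / 2).
Proof.
move=> ip ig xi0; have xi0' : xi != 0 by rewrite gt_eqF.
pose a := pi / xi; have a0 : 0 < a by rewrite divr_gt0// pi_gt0.
(* The indicator of x <= t < x + a; as a function of x it lives on ]t - a, t], an interval of length
   a. *)
pose c x t : R := (x <= t)%R%:R - (x + a <= t)%R%:R.
have cE x t : c x t = \1_(`]t - a, t]%classic : set R) x.
  rewrite /c indicE.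
  have -> : (x \in (`]t - a, t]%classic : set R)) = (t - a < x <= t).
    by apply/idP/idP; rewrite inE /= in_itv.
  have -> : (t - a < x) = ~~ (x + a <= t) by rewrite -ltNge ltrBlDr.
  case: (boolP (x + a <= t)) => [xat|_]; last by rewrite subr0.
  have -> : x <= t by lra.
  by rewrite subrr.
have cc : continuous (fun x : R => cos (xi * x - th)) by exact: continuous_cos_affine.
have mcos := continuous_measurable_fun cc.
have ga_i : L1 (fun x => tail p (x + a)).
  by have := L1_shift (- a) ig; under eq_fun do rewrite opprK.
have gaE : \int[mu]_x (tail p (x + a) * cos (xi * x - th)) = - trig (tail p) xi th.
  rewrite /trig -(Rintegral_shift (- a) (L1_cos xi th ig)).
  rewrite -[RHS]mulN1r -[RHS]RintegralTZl; last exact: (L1_shift (- a) (L1_cos xi th ig)).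
  apply: eq_RintegralT => x; rewrite opprK.
  have -> : xi * (x + a) - th = (xi * x - th) + pi by rewrite /a; field.
  by rewrite cosDpi; ring.
have tailB x : tail p x - tail p (x + a) = \int[mu]_t (p t * c x t).
  rewrite !tailE -(RintegralTB (L1_tail_integrand x ip) (L1_tail_integrand (x + a) ip)).
  by apply: eq_RintegralT => t; rewrite mulrBr.
have c_le1 x t : `|c x t| <= 1.
  by rewrite cE indicE; case: (_ \in _); rewrite ?normr1 ?normr0.
have mc : measurable_fun setT (fun z : R * R => c z.2 z.1).
  apply: measurable_funB; apply: measurable_le_natb => //.
  exact: measurable_funD.
have ci t : L1 (fun x => c x t).
  by under eq_fun do rewrite cE; split; exact: integrable_indic_itv.
pose k t x := p t * (cos (xi * x - th) * c x t).
have mk : measurable_fun setT (fun z : R * R => k z.1 z.2).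
  apply: measurable_funM.
    exact: (measurableT_comp (L1_measurable ip) measurable_fst).
  by apply: measurable_funM => //; exact: (measurableT_comp mcos measurable_snd).
have kt t : L1 (k t).
  apply: L1Zl; under eq_fun do rewrite mulrC.
  exact: (L1Mr (ci t) mcos (fun _ => normr_cos_le1 _)).
have kx x : L1 (k ^~ x).
  apply: (L1Mr ip _ (M := 1)) => [|t].
    apply: measurable_funM => //.
    exact: (measurable_sectionr (k := fun t x => c x t) x mc).
  by rewrite normrM mulr_ile1// normr_cos_le1.
have c_int t : \int[mu]_x c x t = a.
  have E : lebesgue_measure (`]t - a, t]%classic : set R) = a%:E.
    rewrite lebesgue_measure_itv /= lte_fin ltrBlDr ltrDl a0 -EFinB.
    by congr EFin; ring.
  transitivity (\int[mu]_x (1 * \1_(`]t - a, t]%classic : set R) x)).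
    by apply: eq_RintegralT => x; rewrite mul1r cE.
  by rewrite Rintegral_indic Rintegral_cst// [X in fine X]E /= mul1r.
have koo : (\int[mu]_t \int[mu]_x `|k t x|%:E < +oo)%E.
  apply: (@iterated_integral_lty _ k (fun t => a * `|p t|) mk _ kt) => [|t].
    exact/L1Zl/L1_norm.
  rewrite -(c_int t) mulrC -(RintegralTZl _ (ci t)).
  apply: (ler_Rintegral (L1_norm (kt t)) (L1Zl _ (ci t))) => x.
  have c0 : 0 <= c x t by rewrite cE indicE.
  by rewrite /k !normrM (ger0_norm c0) ler_wpM2l// ler_piMl// normr_cos_le1.
(* Over half a period sin y - sin (y - pi) = 2 sin y, and sin y = cos (y - pi / 2) is the source of
   the phase shift. *)
have inner t : \int[mu]_x (cos (xi * x - th) * c x t) =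
    2 / xi * cos (xi * t - (th + pi / 2)).
  transitivity (\int[mu]_(x in `[t - a, t]) cos (xi * x - th)).
    rewrite -Rintegral_itv_obnd_cbnd; last first.
      apply: (@integrableS _ _ _ mu (`[t - a, t]%classic : set R)) => //.
        by apply: subset_itv; rewrite bnd_simp.
      apply: continuous_compact_integrable; first exact: segment_compact.
      exact: continuous_subspaceT.
    by rewrite -[RHS]Rintegral_indic; apply: eq_RintegralT => x; rewrite cE.
  have dF x : is_derive x 1 (fun x => sin (xi * x - th) / xi) (cos (xi * x - th)).
    by apply: is_derive_eq; rewrite /GRing.scale/=; field.
  rewrite (@Rintegral_FTC _ _ _ (t - a) t _ dF cc); last by lra.
  have -> : xi * (t - a) - th = (xi * t - th) - pi by rewrite /a; field.
  have -> : xi * t - (th + pi / 2) = (xi * t - th) - pi / 2 by ring.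
  rewrite (sinB (xi * t - th)) cospi sinpi (cosB (xi * t - th)) cos_pihalf sin_pihalf.
  by field.
have E2 : 2 * trig (tail p) xi th = 2 * (xi^-1 * trig p xi (th + pi / 2)).
  have gcos_i := L1_cos xi th ig.
  have gacos_i : L1 (fun x => tail p (x + a) * cos (xi * x - th)).
    exact: L1_cos.
  have -> : 2 * trig (tail p) xi th = trig (tail p) xi th -
      \int[mu]_x (tail p (x + a) * cos (xi * x - th)) by rewrite gaE; ring.
  rewrite /trig -(RintegralTB gcos_i gacos_i).
  transitivity (\int[mu]_x \int[mu]_t k t x).
    apply: eq_RintegralT => x; rewrite -mulrBl tailB mulrC -RintegralTZl.
      by apply: eq_RintegralT => t; rewrite /k mulrCA.
    apply: (L1Mr ip _ (M := 1)) => [|t //].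
    exact: (measurable_sectionr (k := fun t x => c x t) x mc).
  rewrite -(L1_Fubini mk koo kt kx).
  transitivity (\int[mu]_t ((2 / xi) * (p t * cos (xi * t - (th + pi / 2))))).
    apply: eq_RintegralT => t; rewrite mulrCA -inner -RintegralTZl//.
    under eq_fun do rewrite mulrC.
    exact: (L1Mr (ci t) mcos (fun _ => normr_cos_le1 _)).
  by rewrite (RintegralTZl _ (L1_cos _ _ ip)) -mulrA.
lra.
Qed.

Lemma trigDpi p xi th : L1 p -> trig p xi (th + pi) = - trig p xi th.
Proof.
move=> ip; rewrite -mulN1r -(RintegralTZl _ (L1_cos _ _ ip)).
apply: eq_RintegralT => x.
have -> : xi * x - (th + pi) = (xi * x - th) - pi by ring.
by rewrite cosB cospi sinpi; ring.
Qed.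

(** A negative frequency is reflected by [trigN]; the shift of the phase by pi then restores the
    sign of 1 / xi. *)
Lemma trig_tail p xi th : L1 p -> L1 (tail p) -> xi != 0 ->
  trig (tail p) xi th = xi^-1 * trig p xi (th + pi / 2).
Proof.
move=> ip ig; rewrite neq_lt => /orP[xi0|]; last exact: trig_tail_pos.
have -> : trig (tail p) xi th = trig (tail p) (- xi) (- th) by rewrite trigN opprK.
rewrite trig_tail_pos ?oppr_gt0//.
have -> : - th + pi / 2 = - (th - pi / 2) by ring.
have -> : th + pi / 2 = (th - pi / 2) + pi by field.
by rewrite trigN opprK trigDpi// invrN; ring.
Qed.

(** Away from 0 this is division by xi; the value at 0 follows by continuity of the transform. *)
Lemma spectral_gap_tail a p : L1 p -> L1 (tail p) -> 0 < a ->
  spectral_gap a p -> spectral_gap a (tail p).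
Proof.
move=> ip ig a0 gp xi th xia.
have [->|xi0] := eqVneq xi 0; last by rewrite trig_tail// gp// mulr0.
(* The denominator starts at 2, so that the first term is already strictly inside the gap. *)
have u0 n : `|a / n.+2%:R| < a.
  by rewrite gtr0_norm ?divr_gt0// ltr_pdivrMr// ltr_pMr// ltr1n.
have cu : a / n.+2%:R @[n --> \oo] --> (0 : R).
  rewrite -(mulr0 a); apply: cvgM; first exact: cvg_cst.
  by have := @cvg_harmonic R; rewrite -(cvg_shiftS).
have ct : trig (tail p) x th @[x --> (0 : R)] --> trig (tail p) 0 th.
  exact: (@continuous_trig _ _ th ig 0).
have ctu := @cvg_comp _ _ _ (fun n => a / n.+2%:R) (trig (tail p) ^~ th) _ _ _ cu ct.
apply/esym/(cvg_unique _ _ ctu) => //.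
rewrite (_ : _ \o _ = fun=> 0); first exact: cvg_cst.
apply/funext => n /=; rewrite trig_tail// ?gp ?mulr0//.
by rewrite gt_eqF// divr_gt0.
Qed.

Lemma energy_tail p a xi : L1 p -> 0 < a -> spectral_gap a p ->
  energy (tail p) xi = (xi ^+ 2)^-1 * energy p xi.
Proof.
move=> ip a0 gp; have ig := L1_tail ip a0 gp.
have [->|xi0] := eqVneq xi 0.
  rewrite /energy !gp ?normr0// !(spectral_gap_tail ip ig a0 gp) ?normr0//.
  by rewrite expr0n/= addr0 mulr0.
rewrite /energy !trig_tail// add0r.
(* The tail exchanges the cosine and sine transforms up to sign, which the sum of squares does not
   see. *)
have -> : pi / 2 + pi / 2 = 0 + pi :> R by field.
by rewrite trigDpi//; field.
Qed.

End TailIntegrable.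

(** * Geometric bounds for the L2 norms of the iterated tails *)

Section TailIterates.
Context {R : realType}.
Notation mu := (@lebesgue_measure R).
Implicit Types (f g h p : R -> R) (a b x y t u v s xi th l : R).

Lemma trigN_pihalf p xi : L1 p ->
  trig p (- xi) (pi / 2) = - trig p xi (pi / 2).
Proof.
move=> ip; have -> : trig p xi (pi / 2) = - trig p xi (- (pi / 2)).
  by rewrite -trigDpi//; congr trig; field.
by rewrite trigN opprK.
Qed.

Lemma energyN p xi : L1 p -> energy p (- xi) = energy p xi.
Proof. by move=> ip; rewrite /energy trigN_pihalf// sqrrN trigN oppr0. Qed.

Lemma spectral_gapP a p : L1 p ->
  (forall xi, `|xi| < a -> energy p xi = 0) -> spectral_gap a p.
Proof.
move=> ip ep xi th /ep; rewrite /energy => /eqP.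
rewrite paddr_eq0 ?sqr_ge0// !sqrf_eq0 => /andP[/eqP c0 /eqP s0].
by rewrite trigE// c0 s0 !mulr0 addr0.
Qed.

Lemma energy_gap a p xi : spectral_gap a p -> `|xi| < a -> energy p xi = 0.
Proof. by move=> gp xia; rewrite /energy !gp// expr0n addr0. Qed.

Section Iterates.
Context (p : R -> R) (a : R).
Context (ip : L1 p) (a0 : 0 < a) (gp : spectral_gap a p).
Notation p_ n := (iter n tail p).

(** The claims are proved together because integrability of the next tail requires the gap of the
    current one. *)
Lemma tail_iter n : [/\ L1 (p_ n), spectral_gap a (p_ n) &
  forall xi, energy (p_ n) xi = (xi ^+ 2)^-1 ^+ n * energy p xi].
Proof.
elim: n => [|n [ipn gpn en]].
  by split=> // xi; rewrite expr0 mul1r.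
have ign := L1_tail ipn a0 gpn.
split=> /=; [exact: ign|exact: spectral_gap_tail|move=> xi].
by rewrite (energy_tail xi ipn a0 gpn) en (exprS _ n) mulrA.
Qed.

Lemma L1_tail_iter n : L1 (p_ n).
Proof. by have [] := tail_iter n. Qed.

Lemma energy_tail_iter n xi :
  energy (p_ n) xi = (xi ^+ 2)^-1 ^+ n * energy p xi.
Proof. by have [] := tail_iter n. Qed.

(** A tail is bounded by the L1 norm of the function it comes from, and a bounded integrable
    function is square integrable; hence the index starts at 1. *)
Lemma L1_sqr_tail_iter n : L1 (fun x => p_ n.+1 x ^+ 2).
Proof.
apply: (L1Mr (L1_tail_iter n.+1) (L1_measurable (L1_tail_iter n.+1))) => x.
exact: (tail_bound x (L1_tail_iter n)).
Qed.

(** The energy of the iterate n + 1 is xi^(-2n) times that of the first one. It vanishes for |xi| <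
    a, and beyond that the factor is at most a^(-2n), so [plancherel_le] applies with a geometric
    constant. *)
Lemma sqr_tail_iter_upper : exists2 K : R, 0 <= K &
  forall n, \int[mu]_x p_ n.+1 x ^+ 2 <= K * (a ^+ 2)^-1 ^+ n.
Proof.
pose N f := \int[mu]_x `|f x|.
(* The first term bounds the energy of [tail p], the second one bounds xi^2 times it, which is the
   energy of p when xi is nonzero. *)
pose M := 2 * N (tail p) ^+ 2 + 2 * N p ^+ 2.
pose P := \int[mu]_y (1 + y ^+ 2 : R)^-1.
pose kap := \int[mu]_y (@fejer R y).
have kap0 : 0 < kap by exact: Rintegral_fejer_gt0.
have M0 : 0 <= M by rewrite addr_ge0// mulr_ge0// sqr_ge0.
have P0 : 0 <= P.
  by apply: Rintegral_ge0 => y _; rewrite invr_ge0 addr_ge0// sqr_ge0.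
exists (2 * M * P / kap).
  by apply: divr_ge0; [do 2 apply: mulr_ge0 => //|exact: ltW].
move=> n; have a2 : 0 < a ^+ 2 by rewrite exprn_gt0.
have eM xi : energy (p_ 1) xi <= M * (1 + xi ^+ 2)^-1.
  rewrite ler_pdivlMr ?ltr_pwDl ?sqr_ge0// mulrDr mulr1.
  apply: lerD; first exact: (energy_le xi (L1_tail_iter 1)).
  rewrite energy_tail_iter expr1.
  have [->|xi0] := eqVneq xi 0.
    by rewrite expr0n /= mulr0 mulr_ge0// sqr_ge0.
  by rewrite mulrAC mulVf ?sqrf_eq0// mul1r; exact: energy_le.
have enM xi : energy (p_ n.+1) xi <= M * (a ^+ 2)^-1 ^+ n * (1 + xi ^+ 2)^-1.
  have -> : energy (p_ n.+1) xi = (xi ^+ 2)^-1 ^+ n * energy (p_ 1) xi.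
    by rewrite !energy_tail_iter (exprSr _ n) mulrA expr1.
  have [xia|axi] := ltP `|xi| a.
    rewrite (energy_gap _ xia); last by have [] := tail_iter 1.
    by rewrite mulr0 !mulr_ge0// ?exprn_ge0// invr_ge0 ?addr_ge0// ?sqr_ge0// ltW.
  rewrite (mulrC M) -mulrA; apply: ler_pM; rewrite ?energy_ge0// ?eM//.
    by rewrite exprn_ge0// invr_ge0 sqr_ge0.
  rewrite lerXn2r ?nnegrE ?invr_ge0 ?sqr_ge0//.
  have xi2 : a ^+ 2 <= xi ^+ 2.
    by rewrite -[leRHS]real_normK ?num_real// ler_sqr ?nnegrE// ltW.
  by rewrite lef_pV2 ?posrE// (lt_le_trans a2).
have := plancherel_le (L1_tail_iter n.+1) (continuous_tail (L1_tail_iter n))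
  (fun x => tail_bound x (L1_tail_iter n)) enM.
rewrite -/P -/kap mulrC -ler_pdivlMr// => /le_trans; apply.
by rewrite le_eqVlt; apply/orP; left; apply/eqP; ring.
Qed.

(** On ]0, l] the factor xi^(-2(n + 1)) is at least l^(-2(n + 1)), so the weighted energy of the
    iterate over [0, l] is at least that multiple of [W], and Schur's bound transfers this to the L2
    norm. *)
Lemma sqr_tail_iter_lower l xi : `|xi| < l -> energy p xi != 0 ->
  exists2 c : R, 0 < c &
  forall n, c * (l ^+ 2)^-1 ^+ n.+1 <= \int[mu]_x p_ n.+1 x ^+ 2.
Proof.
move=> xil exi; have l0 : 0 < l by exact: le_lt_trans xil.
pose kap := \int[mu]_y (@fejer R y).
have kap0 : 0 < kap by exact: Rintegral_fejer_gt0.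
pose W := \int[mu]_s (fejer_weight s * energy p (l * s)).
have xi0 : 0 < `|xi|.
  rewrite normr_gt0; apply: contraNneq exi => ->.
  by rewrite (energy_gap gp)// normr0.
(* The integrand is continuous and positive at s = |xi| / l, which lies strictly between 0 and 1. *)
have W0 : 0 < W.
  apply: (@Rintegral_gt0 _ _ (`|xi| / l) (L1_fejer_weight_energy l ip)) => [s||].
  - by rewrite mulr_ge0 ?fejer_weight_ge0 ?energy_ge0.
  - apply: cvgM.
      by apply: fejer_weight_continuous; [rewrite divr_gt0|rewrite ltr_pdivrMr// mul1r].
    apply: (@continuous_comp _ _ _ ( *%R l) (energy p)); first exact: mulrl_continuous.
    exact: continuous_energy.
  - have -> : l * (`|xi| / l) = `|xi| by rewrite mulrC divfK// gt_eqF.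
    apply: mulr_gt0.
      rewrite /fejer_weight indic01E.
      have xl : `|xi| / l < 1 by rewrite ltr_pdivrMr// mul1r.
      have xl0 : 0 <= `|xi| / l by rewrite divr_ge0// ltW.
      by rewrite xl0 ltW// mulr1 mulr_gt0// subr_gt0.
    rewrite lt_neqAle energy_ge0 andbT eq_sym.
    by case: (ger0P xi) => _; rewrite ?energyN.
exists (W * l / kap); first by rewrite divr_gt0// mulr_gt0.
move=> n; have Ln := L1_tail_iter n.+1.
have := fejer_weight_energy_le l0 Ln (L1_sqr_tail_iter n).
rewrite -/kap => H.
have H' : (l ^+ 2)^-1 ^+ n.+1 * W <=
    \int[mu]_s (fejer_weight s * energy (p_ n.+1) (l * s)).
  rewrite -(RintegralTZl _ (L1_fejer_weight_energy l ip)).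
  apply: (ler_Rintegral (L1Zl _ (L1_fejer_weight_energy l ip))
    (L1_fejer_weight_energy l Ln)) => s.
  rewrite mulrCA.
  have [/andP[s0 s1]|s01] := boolP (0 <= s <= 1); last first.
    by rewrite (fejer_weight_out s01) !mul0r.
  rewrite ler_wpM2l ?fejer_weight_ge0// energy_tail_iter.
  (* At s = 0 the inverse takes its default value 0, but the frequency 0 lies in the gap, where the
     energy of p vanishes. *)
  have [->|sn0] := eqVneq s 0.
    by rewrite mulr0 (energy_gap gp) ?normr0// !mulr0.
  have s_gt0 : 0 < s by rewrite lt_neqAle eq_sym sn0.
  rewrite ler_wpM2r ?energy_ge0// lerXn2r ?nnegrE ?invr_ge0 ?sqr_ge0//.
  have ls : 0 < l * s by rewrite mulr_gt0.
  rewrite lef_pV2 ?posrE ?exprn_gt0// ler_sqr ?nnegrE ?(ltW ls) ?(ltW l0)//.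
  by rewrite ler_piMr// ltW.
rewrite -(ler_pM2l (x := kap / l)) ?divr_gt0//; apply: le_trans H.
apply: le_trans H'; rewrite le_eqVlt; apply/orP; left; apply/eqP.
by move: ((l ^+ 2)^-1 ^+ n.+1) => z; field; rewrite (gt_eqF l0) (gt_eqF kap0).
Qed.

End Iterates.

End TailIterates.

(** * Root limits by comparison with geometric sequences *)

Section RootLimit.
Context {R : realType}.
Implicit Types (I : nat -> R) (r rho : R).

Lemma sqr_root_powR r n : 0 <= r ->
  (((r ^+ 2) ^+ n.+1) `^ 2^-1) `^ n.+1%:R^-1 = r.
Proof.
move=> r0; rewrite -exprM -powR_mulrn// -!powRrM natrM.
rewrite -[RHS]powRr1//; congr (_ `^ _).
by rewrite mulrACA !divff ?mulr1 ?pnatr_eq0.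
Qed.

Lemma root_cvg I rho : 0 <= rho -> (forall n, 0 <= I n) ->
  (forall r, rho < r -> \forall n \near \oo, I n <= (r ^+ 2) ^+ n.+1) ->
  (forall r, 0 < r -> r < rho -> \forall n \near \oo, (r ^+ 2) ^+ n.+1 <= I n) ->
  (I n `^ 2^-1) `^ n.+1%:R^-1 @[n --> \oo] --> rho.
Proof.
move=> rho0 I0 upper lower; apply/cvgrPdist_le => e e0.
have re : rho < rho + e by rewrite ltrDl.
have mono n (x y : R) : 0 <= x -> x <= y ->
    (x `^ 2^-1) `^ n.+1%:R^-1 <= (y `^ 2^-1) `^ n.+1%:R^-1.
  move=> x0 xy.
  apply: ge0_ler_powR; rewrite ?nnegrE ?powR_ge0 ?invr_ge0//.
  by apply: ge0_ler_powR; rewrite ?nnegrE ?invr_ge0// (le_trans x0).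
have H1 : \forall n \near \oo, (I n `^ 2^-1) `^ n.+1%:R^-1 <= rho + e.
  have := upper _ re; apply: filterS => n In.
  by rewrite -[leRHS](@sqr_root_powR _ n) ?mono// addr_ge0// ltW.
have H2 : \forall n \near \oo, rho - e <= (I n `^ 2^-1) `^ n.+1%:R^-1.
  have [er|er] := leP (rho - e) 0.
    by apply: nearW => n; rewrite (le_trans er)// powR_ge0.
  have re' : rho - e < rho by rewrite ltrBlDr ltrDl.
  have := lower _ er re'; apply: filterS => n In.
  rewrite -[leLHS](sqr_root_powR n (ltW er)); apply: mono => //.
  by rewrite exprn_ge0// sqr_ge0.
apply: filterS2 H1 H2 => n h1 h2.
by rewrite ler_distlC h2 h1.
Qed.

(** K (x / y)^n tends to 0, hence is eventually below y, which pays for the extra power. *)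
Lemma near_le_geometric (x y : R) (K : R) : 0 <= x -> x < y ->
  0 < y -> \forall n \near \oo, K * x ^+ n <= y ^+ n.+1.
Proof.
move=> x0 xy y0.
have z1 : `|x / y| < 1 by rewrite ger0_norm ?divr_ge0 ?(ltW y0)// ltr_pdivrMr// mul1r.
have cz : K * (x / y) ^+ n @[n --> \oo] --> K * 0.
  by apply: cvgM; [exact: cvg_cst|exact: cvg_expr].
have := @cvgr_lt R nat \oo _ _ _ cz y; rewrite mulr0 => /(_ _ y0).
apply: filterS => n /ltW.
by rewrite expr_div_n mulrA ler_pdivrMr ?exprn_gt0// -exprS.
Qed.

End RootLimit.

(** * From the offset linear canonical transform to cosine and sine transforms *)

Section Olct.
Context {R : realType}.
Notation mu := (@lebesgue_measure R).
Notation Re := (@complex.Re R).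
Notation Im := (@complex.Im R).
Implicit Types (s t u x xi : R) (z : R[i]) (h : R -> R[i]).

Lemma expiD s t : expi (s + t) = expi s * expi t.
Proof.
rewrite /expi cosD sinD; apply/eqP; rewrite eq_complex /=.
by apply/andP; split; apply/eqP; ring.
Qed.

Lemma expi0 : expi (0 : R) = 1.
Proof. by rewrite /expi cos0 sin0. Qed.

Lemma expi_neq0 t : expi t != 0.
Proof.
apply/eqP => e0; have := expiD t (- t).
by rewrite subrr expi0 e0 mul0r => /eqP; rewrite oner_eq0.
Qed.

Lemma Re_expiM t z : Re (expi t * z) = cos t * Re z - sin t * Im z.
Proof. by case: z => x y. Qed.

Lemma Im_expiM t z : Im (expi t * z) = cos t * Im z + sin t * Re z.
Proof. by case: z => x y /=; rewrite mulrC. Qed.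

Lemma cintegrableTP h : cintegrable setT h <->
  L1 (fun x => Re (h x)) /\ L1 (fun x => Im (h x)).
Proof.
by split=> [[hr hi]|[[hr] [hi]]]; split=> //; split.
Qed.

Lemma cintegrable_expiM (phase : R -> R) h : continuous phase ->
  cintegrable setT h -> cintegrable setT (fun x => expi (phase x) * h x).
Proof.
move=> cp /cintegrableTP[hr hi].
have mc : measurable_fun setT (fun x => cos (phase x)).
  apply: (@measurableT_comp _ _ _ _ _ _ cos); apply: continuous_measurable_fun => //.
  exact: continuous_cos.
have ms : measurable_fun setT (fun x => sin (phase x)).
  apply: (@measurableT_comp _ _ _ _ _ _ sin); apply: continuous_measurable_fun => //.
  exact: continuous_sin.
have sin1 x : `|sin (phase x)| <= 1 by rewrite ler_norml sin_geN1 sin_le1.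
apply/cintegrableTP; split.
  under eq_fun do rewrite Re_expiM mulrC (mulrC (sin _)).
  by apply: L1B; [exact: (L1Mr hr mc (fun _ => normr_cos_le1 _))|exact: (L1Mr hi ms)].
under eq_fun do rewrite Im_expiM mulrC (mulrC (sin _)).
by apply: L1D; [exact: (L1Mr hi mc (fun _ => normr_cos_le1 _))|exact: (L1Mr hr ms)].
Qed.

Lemma cintegralZl z h : cintegrable setT h ->
  cintegral setT (fun x => z * h x) = z * cintegral setT h.
Proof.
case: z => zr zi /cintegrableTP[hr hi]; rewrite /cintegral.
apply/eqP; rewrite eq_complex /=; apply/andP; split; apply/eqP.
  rewrite -(RintegralTZl _ hr) -(RintegralTZl _ hi).
  rewrite -(RintegralTB (L1Zl zr hr) (L1Zl zi hi)).
  by apply: eq_RintegralT => x; case: (h x).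
rewrite -(RintegralTZl _ hr) -(RintegralTZl _ hi).
rewrite -(RintegralTD (L1Zl zr hi) (L1Zl zi hr)).
by apply: eq_RintegralT => x; case: (h x).
Qed.

Section Fixed.
Context (a b c d u0 w0 : R) (f : R -> R[i]).
Context (b0 : b != 0) (hf : cintegrable setT f).

Definition dechirped x : R[i] := expi (chirp a b u0 x) * f x.
Let p x := Re (dechirped x).
Let q x := Im (dechirped x).

Lemma continuous_chirp : continuous (chirp a b u0).
Proof.
move=> x; apply: cvgM; first exact: cvg_cst.
apply: cvgD.
  by apply: cvgM; [exact: cvg_cst|exact: exprn_continuous].
apply: cvgM; last exact: cvg_cst.
by apply: cvgM; [exact: cvg_cst|exact: cvg_id].
Qed.

Lemma cintegrable_dechirped : cintegrable setT dechirped.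
Proof. by apply: cintegrable_expiM => //; exact: continuous_chirp. Qed.

(** The outer chirp of one application of B cancels the inner chirp of the next, so only the tails
    of p and q accumulate. *)
Lemma BpowE n x : Bpow a b u0 n f x =
  expi (- chirp a b u0 x) * (iter n tail p x +i* iter n tail q x).
Proof.
elim: n x => [|n IHn] x.
  rewrite /= /p /q /dechirped.
  have -> z : Re z +i* Im z = z by case: z.
  by rewrite mulrA -expiD addNr expi0 mul1r.
rewrite /Bpow /= -/(Bpow a b u0 n f) /Bop; congr (_ * _).
have E t : expi (chirp a b u0 t) * Bpow a b u0 n f t =
    iter n tail p t +i* iter n tail q t.
  by rewrite IHn mulrA -expiD addrN expi0 mul1r.
by rewrite /cintegral /tail; congr (_ +i* _); apply: eq_Rintegral => t _; rewrite E.
Qed.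

Lemma Bop_definedE n : L1 (iter n tail p) -> L1 (iter n tail q) ->
  Bop_defined a b u0 (Bpow a b u0 n f).
Proof.
move=> [ip] [iq] x.
have E t : expi (chirp a b u0 t) * Bpow a b u0 n f t =
    iter n tail p t +i* iter n tail q t.
  by rewrite BpowE mulrA -expiD addrN expi0 mul1r.
split; apply: (@integrableS _ _ _ mu setT) => //.
  by move: ip; apply: eq_integrable => // t _; rewrite E.
by move: iq; apply: eq_integrable => // t _; rewrite E.
Qed.

Lemma cintegrable_Bpow n : L1 (iter n tail p) -> L1 (iter n tail q) ->
  cintegrable setT (Bpow a b u0 n f).
Proof.
move=> ip iq; rewrite (funext (BpowE n)); apply: cintegrable_expiM.
  by move=> x; apply: cvgN; exact: continuous_chirp.
exact/cintegrableTP.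
Qed.

Lemma L2norm_Bpow n :
  L2norm (Bpow a b u0 n f) =
  ((\int[mu]_x ((iter n tail p x ^+ 2 + iter n tail q x ^+ 2)%:E)) `^ 2^-1)%E.
Proof.
rewrite /L2norm unlock; congr (_ `^ _)%E; apply: eq_integral => x _.
rewrite BpowE; set P := iter n tail p x; set Q := iter n tail q x.
set t := - chirp a b u0 x; rewrite abse_EFin poweR_EFin; congr EFin.
rewrite powR_mulrn// real_normK ?num_real//= sqr_sqrtr ?addr_ge0 ?sqr_ge0//.
have := cos2Dsin2 t; set C := cos t; set S := sin t => CS.
rewrite -[RHS]mul1r -CS; ring.
Qed.

(** The kernel's phase splits into a part depending on u alone, the Fourier phase - u x / b, and the
    chirp; z collects the constant and the first part. *)
Lemma olctE u : exists2 z : R[i], z != 0 & olct a b c d u0 w0 f u =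
  z * ((trig p (u / b) 0 + trig q (u / b) (pi / 2)) +i*
       (trig q (u / b) 0 - trig p (u / b) (pi / 2))).
Proof.
pose z0 := sqrtc (1 / ((2 * pi)%:C * 'i%C * b%:C)) * expi ((2 * b)^-1 * (d * u0 ^+ 2)).
pose r := (2 * b)^-1 * (d * u ^+ 2 - 2 * u * (d * u0 - b * w0)).
exists (z0 * expi r).
  rewrite !mulf_neq0 ?expi_neq0//.
  (* The square root is nonzero because its square is. *)
  rewrite -(sqrf_eq0 (sqrtc _)) sqr_sqrtc.
  rewrite div1r invr_eq0 !mulf_neq0// eq_complex /= ?negb_and ?oner_eq0 ?orbT//.
    by rewrite mulf_neq0// gt_eqF// pi_gt0.
  by rewrite b0.
have [ip iq] := (cintegrableTP dechirped).1 cintegrable_dechirped.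
have E x : olct_kernel a b c d u0 w0 u x * f x =
    (z0 * expi r) * (expi (- (u / b * x)) * dechirped x).
  rewrite /olct_kernel -/z0 /dechirped.
  have -> : (2 * b)^-1 * (a * x ^+ 2 + 2 * x * (u0 - u)
      - 2 * u * (d * u0 - b * w0) + d * u ^+ 2) =
      r + - (u / b * x) + chirp a b u0 x.
    by rewrite /r /chirp; field.
  by rewrite !expiD; ring.
rewrite /olct (funext E) cintegralZl; last first.
  apply: cintegrable_expiM; last exact: cintegrable_dechirped.
  by move=> x; apply: cvgN; exact: mulrl_continuous.
congr (_ * _); rewrite /cintegral /trig; congr (_ +i* _).
  rewrite -(RintegralTD (L1_cos _ _ ip) (L1_cos _ _ iq)).
  apply: eq_RintegralT => x; rewrite Re_expiM subr0 cosN sinN cosB cos_pihalf sin_pihalf.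
  by rewrite /p /q; ring.
rewrite -(RintegralTB (L1_cos _ _ iq) (L1_cos _ _ ip)).
apply: eq_RintegralT => x; rewrite Im_expiM subr0 cosN sinN cosB cos_pihalf sin_pihalf.
by rewrite /p /q; ring.
Qed.

Let L1p : L1 p.
Proof. by have [] := (cintegrableTP dechirped).1 cintegrable_dechirped. Qed.

Let L1q : L1 q.
Proof. by have [] := (cintegrableTP dechirped).1 cintegrable_dechirped. Qed.

Lemma olct_eq0 u : (olct a b c d u0 w0 f u == 0) =
  (trig p (u / b) 0 + trig q (u / b) (pi / 2) == 0) &&
  (trig q (u / b) 0 - trig p (u / b) (pi / 2) == 0).
Proof.
have [z z0 ->] := olctE u.
by rewrite mulf_eq0 (negPf z0) /= eq_complex.
Qed.

Lemma olct_neq0_energy u : olct a b c d u0 w0 f u != 0 ->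
  (energy p (u / b) != 0) || (energy q (u / b) != 0).
Proof.
rewrite -negb_and; apply: contraNN => /andP[].
rewrite /energy !paddr_eq0 ?sqr_ge0// !sqrf_eq0 olct_eq0.
by move=> /andP[/eqP-> /eqP->] /andP[/eqP-> /eqP->]; rewrite addr0 subrr eqxx.
Qed.

(* The two values at u and -u determine the cosine and sine transforms of both
   the real and the imaginary part. *)
Lemma olct_eq0_energy u : olct a b c d u0 w0 f u = 0 ->
  olct a b c d u0 w0 f (- u) = 0 -> energy p (u / b) = 0 /\ energy q (u / b) = 0.
Proof.
move=> /eqP; rewrite olct_eq0 => /andP[/eqP e1 /eqP e2].
move=> /eqP; rewrite olct_eq0 mulNr !trigN_pihalf// !(trigN _ _ 0) !oppr0.
move=> /andP[/eqP e3 /eqP e4]; rewrite /energy.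
have -> : trig p (u / b) 0 = 0 by lra.
have -> : trig p (u / b) (pi / 2) = 0 by lra.
have -> : trig q (u / b) 0 = 0 by lra.
have -> : trig q (u / b) (pi / 2) = 0 by lra.
by rewrite expr0n addr0.
Qed.

(** The condition on u is symmetric, so [olct_eq0_energy] applies at u = xi b. *)
Lemma olct_spectral_gap (r : R) :
  (forall u, `|u / b| < r -> olct a b c d u0 w0 f u = 0) ->
  spectral_gap r p /\ spectral_gap r q.
Proof.
move=> H.
have e0 xi : `|xi| < r -> energy p xi = 0 /\ energy q xi = 0.
  move=> xir; rewrite -(mulfK b0 xi).
  by apply: olct_eq0_energy; apply: H; rewrite ?mulNr ?normrN mulfK.
by split; apply: spectral_gapP => // xi /e0[].
Qed.

Notation gap := (olct_gap a b c d u0 w0 f).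

Lemma olct_gap_ge0 : (0 <= gap)%E.
Proof. by apply/ereal_infP => _ [u _ <-]; rewrite lee_fin. Qed.

Lemma olct_eq0_gap (r : R) u : (r%:E <= gap)%E -> `|u / b| < r ->
  olct a b c d u0 w0 f u = 0.
Proof.
move=> rG ur; apply/eqP/negPn/negP => ou.
have : (gap <= `|u / b|%:E)%E.
  by apply: ereal_inf_lbound; exists u => //; exact: subset_closure.
by move/(le_trans rG); rewrite lee_fin leNgt ur.
Qed.

Let nbhs_lt (l : R) u : `|u / b| < l -> \forall v \near u, `|v / b| < l.
Proof.
move=> ul; apply: (@cvgr_lt R R (nbhs u) _ (fun v => `|v / b|) `|u / b|) => //.
by apply: cvg_norm; apply: cvgM; [exact: cvg_id|exact: cvg_cst].
Qed.

(** A point of the support is only a limit of points where the transform is nonzero; since |u / b| <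
    l is an open condition, one of these satisfies it too. *)
Lemma olct_gap_lt (l : R) : (gap < l%:E)%E ->
  exists2 u, `|u / b| < l & olct a b c d u0 w0 f u != 0.
Proof.
move=> /ereal_inf_lt[_ [u su <-]]; rewrite lte_fin => ul.
by have [v [ov vl]] := su _ (nbhs_lt ul); exists v.
Qed.

(** A ball of radius e without values corresponds to a gap of at least e / |b|, again because the
    support is a closure. An infinite gap is handled with the radius 1. *)
Lemma olct_gap_gt0P : (0 < gap)%E <->
  \forall u \near (0 : R), olct a b c d u0 w0 f u = 0.
Proof.
split=> [G0|].
  have [r r0 rG] : exists2 r : R, 0 < r & (r%:E <= gap)%E.
    case: (gap) G0 => [r r0|_|//]; first by exists r.
    by exists 1; rewrite ?ltr01 ?leey.
  have := @nbhs_lt r 0; rewrite mul0r normr0 => /(_ r0).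
  by apply: filterS => u /(olct_eq0_gap rG).
move=> [e /= e0 He].
apply: (@lt_le_trans _ _ (e / `|b|)%:E); first by rewrite lte_fin divr_gt0// normr_gt0.
apply/ereal_infP => _ [u su <-]; rewrite lee_fin leNgt; apply/negP => ue.
have [v [ov ve]] := su _ (nbhs_lt ue).
move/eqP: ov; apply; apply: He.
by rewrite /= sub0r normrN -(divfK b0 v) normrM -ltr_pdivlMr ?normr_gt0.
Qed.

(** * Iterates of B under a positive gap, and the limit of their norms *)

Section PositiveGap.
Context (gap0 : (0 < gap)%E).

Let gap_spectral (r : R) : (r%:E <= gap)%E -> spectral_gap r p /\ spectral_gap r q.
Proof. by move=> rG; apply: olct_spectral_gap => u; exact: olct_eq0_gap. Qed.

Let exists_gap : exists2 r : R, 0 < r & (r%:E <= gap)%E.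
Proof.
case: (gap) gap0 => [r r0|_|//]; first by exists r.
by exists 1; rewrite ?ltr01 ?leey.
Qed.

Let L1_iter n : L1 (iter n tail p) /\ L1 (iter n tail q).
Proof.
have [r r0 /gap_spectral[gp gq]] := exists_gap.
by split; [exact: (L1_tail_iter L1p r0 gp)|exact: (L1_tail_iter L1q r0 gq)].
Qed.

Lemma Bpow_defined_cintegrable n :
  Bpow_defined a b u0 n f /\ cintegrable setT (Bpow a b u0 n f).
Proof.
split=> [k _|]; last by apply: cintegrable_Bpow; have [] := L1_iter n.
by apply: Bop_definedE; have [] := L1_iter k.
Qed.

(** The squared L2 norm of the iterate n + 1 of B; the shift ensures that it is finite and leaves
    the limit unchanged. *)
Let L2sqr n : R := \int[mu]_x (iter n.+1 tail p x ^+ 2) +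
  \int[mu]_x (iter n.+1 tail q x ^+ 2).

Let L2sqr_ge0 n : 0 <= L2sqr n.
Proof. by rewrite addr_ge0// Rintegral_ge0// => x _; exact: sqr_ge0. Qed.

Let L2norm_iter n :
  (L2norm (Bpow a b u0 n.+1 f) `^ n.+1%:R^-1)%E =
  (((L2sqr n `^ 2^-1) `^ n.+1%:R^-1)%R)%:E.
Proof.
have [r r0 /gap_spectral[gp gq]] := exists_gap.
have p2 := L1_sqr_tail_iter L1p r0 gp n.
have q2 := L1_sqr_tail_iter L1q r0 gq n.
by rewrite L2norm_Bpow -(Rintegral_EFin (L1D p2 q2)) (RintegralTD p2 q2) !poweR_EFin.
Qed.

Let L2sqr_upper (x r : R) : 0 < r -> (r%:E <= gap)%E -> 0 < x -> r^-1 < x ->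
  \forall n \near \oo, L2sqr n <= (x ^+ 2) ^+ n.+1.
Proof.
move=> r0 /gap_spectral[gp gq] x0 rx.
have [K1 _ H1] := sqr_tail_iter_upper L1p r0 gp.
have [K2 _ H2] := sqr_tail_iter_upper L1q r0 gq.
have := @near_le_geometric _ (r ^+ 2)^-1 (x ^+ 2) (K1 + K2).
rewrite -exprVn sqr_ge0 exprn_gt0// ltr_sqr ?nnegrE ?invr_ge0 ?(ltW r0) ?(ltW x0)//.
move=> /(_ isT rx isT); apply: filterS => n; apply: le_trans.
by rewrite exprVn mulrDl lerD.
Qed.

(** At some frequency below l at least one of p and q has energy; its lower bound suffices, as the
    other one contributes a nonnegative amount. *)
Let L2sqr_lower (x l : R) : (gap < l%:E)%E -> 0 < x -> x < l^-1 ->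
  \forall n \near \oo, (x ^+ 2) ^+ n.+1 <= L2sqr n.
Proof.
move=> Gl x0 xl; have [r r0 /gap_spectral[gp gq]] := exists_gap.
have l0 : 0 < l by rewrite -lte_fin (lt_trans gap0).
have [cc cc0 H] : exists2 cc : R, 0 < cc &
    forall n, cc * (l ^+ 2)^-1 ^+ n.+1 <= L2sqr n.
  have [u ul /olct_neq0_energy /orP[ep|eq]] := olct_gap_lt Gl.
    have [cc cc0 H] := sqr_tail_iter_lower L1p r0 gp ul ep.
    exists cc => // n; rewrite (le_trans (H n))// lerDl.
    by apply: Rintegral_ge0 => y _; exact: sqr_ge0.
  have [cc cc0 H] := sqr_tail_iter_lower L1q r0 gq ul eq.
  exists cc => // n; rewrite (le_trans (H n))// lerDr.
  by apply: Rintegral_ge0 => y _; exact: sqr_ge0.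
(* The constant provides the missing power of x^2 and moves [cc] to the other side. *)
have := @near_le_geometric _ (x ^+ 2) (l ^+ 2)^-1 (x ^+ 2 / cc).
rewrite -exprVn sqr_ge0 exprn_gt0 ?invr_gt0//.
rewrite ltr_sqr ?nnegrE ?invr_ge0 ?(ltW l0) ?(ltW x0)//.
move=> /(_ isT xl isT); apply: filterS => n.
rewrite mulrAC -exprS ler_pdivrMr// mulrC => /le_trans; apply.
by rewrite exprVn.
Qed.

Lemma root_L2norm_cvg :
  (fun n => (L2norm (Bpow a b u0 n f) `^ n%:R^-1)%E) @ \oo -->
  olct_radius a b c d u0 w0 f.
Proof.
rewrite -cvg_shiftS (funext L2norm_iter) /olct_radius.
(* Common to finite and infinite gaps: reals r below the gap give upper bounds, reals l above it
   give lower bounds. *)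
have radius_cvg rho : gap^-1%E = rho%:E -> 0 <= rho ->
    (forall x, rho < x -> exists r : R, [/\ 0 < r, (r%:E <= gap)%E & r^-1 < x]) ->
    (forall x, 0 < x -> x < rho -> exists2 l : R, (gap < l%:E)%E & x < l^-1) ->
    (((L2sqr n `^ 2^-1) `^ n.+1%:R^-1)%:E @[n --> \oo] --> gap^-1)%E.
  move=> -> rho0 up low; apply: cvg_EFin; first exact: nearW.
  apply: root_cvg => // x xr.
    have [r [r0 rG rx]] := up _ xr.
    exact: (L2sqr_upper r0 rG (le_lt_trans rho0 xr) rx).
  by move=> /(low _ xr)[l lG xl]; exact: (L2sqr_lower lG xr xl).
case G : gap gap0 => [g||//]; rewrite ?lte_fin => g0.
- rewrite -G; apply: (radius_cvg g^-1).
  + by rewrite G inver gt_eqF.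
  + by rewrite invr_ge0 ltW.
  + by move=> x gx; exists g; rewrite G.
  (* The midpoint of g and 1 / x lies strictly between them. *)
  + move=> x x0 xg; pose l := (g + x^-1) / 2.
    have gx : g < x^-1 by rewrite -(invrK g) ltf_pV2 ?posrE ?invr_gt0.
    exists l; first by rewrite G lte_fin /l; lra.
    by rewrite -(invrK x) ltf_pV2 ?posrE ?invr_gt0// /l; lra.
- rewrite -G; apply: (radius_cvg 0).
  + by rewrite G invey.
  + by [].
  (* Every real is below an infinite gap; 2 / x has inverse x / 2 < x. *)
  + move=> x x0; exists (2 / x); rewrite divr_gt0// G leey; split=> //.
    by rewrite invf_div; lra.
  + by move=> x x0 /(lt_trans x0); rewrite ltxx.
Qed.

End PositiveGap.

End Fixed.
End Olct.

Unset Implicit Arguments.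

(** Both sides amount to a positive gap: on the left by [olct_gap_gt0P], on the right because the
    inverse of the gap is infinite exactly when the gap is 0. *)
Theorem theorem4p3 (R : realType) (a b c d u0 w0 : R) (hb : b != 0)
    (f : R -> R[i]) (hf : cintegrable setT f) :
  (\forall u \near (0 : R), olct a b c d u0 w0 f u = 0) <->
  ((forall n : nat, (0 < n)%N ->
      Bpow_defined a b u0 n f /\ cintegrable setT (Bpow a b u0 n f)) /\
   ((fun n : nat => (L2norm (Bpow a b u0 n f) `^ (n%:R)^-1)%E) @ \oo -->
      olct_radius a b c d u0 w0 f) /\
   (olct_radius a b c d u0 w0 f < +oo)%E).
Proof.
split=> [/(olct_gap_gt0P a c d u0 w0 f hb).2 gap0|[_ [_ Rlty]]].
  split=> [n _|]; first exact: Bpow_defined_cintegrable hb hf gap0 n.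
  split; first exact: root_L2norm_cvg.
  rewrite /olct_radius ltey inve_eqy; apply: contraTneq gap0 => ->.
  by rewrite ltxx.
apply/(olct_gap_gt0P a c d u0 w0 f hb).1.
rewrite lt_neqAle olct_gap_ge0 andbT eq_sym.
by move: Rlty; rewrite /olct_radius ltey inve_eqy.
Qed.
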